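(* Assume the sampling oracle and the functions satisfy assumptions (A1), (A2), (A3), (A4) listed in the context. Write $F(\mathbf{x}) := \mathbb{E}_v[f_v(\mathbb{E}_w[g_w(\mathbf{x})])]$, suppose that $R(\mathbf{x})=0$ for all $\mathbf{x}$ in the problem $\min_{\mathbf{x}} F(\mathbf{x})+R(\mathbf{x})$, and suppose that $\mathbb{E}(F(\mathbf{x}_k))$ is bounded from above (uniformly in $k$), where $\{\mathbf{x}_k\}$ are the iterates of the ASC-PG algorithm described in the context. Choose $\alpha_k = k^{-a}$ and $\beta_k = 2k^{-b}$ with $a\in(0,1)$ and $b\in(0,1)$ in the algorithm. Let $\iota_K := \log K$ if $4a-4b=1$ and $\iota_K:=1$ otherwise. Then $$\frac{\sum_{k=1}^K \mathbb{E}(\|\nabla F(\mathbf{x}_k)\|^2)}{K} \leq O\left(K^{a-1} + L_f^2 L_g K^{4b-4a}\,\iota_K + L_f^2 K^{-b}+ K^{-a}\right).$$ If $L_g\neq 0$ and $L_f\neq 0$, the choice $a=5/9$ and $b=4/9$ yields $$\frac{\sum_{k=1}^K \mathbb{E}(\|\nabla F(\mathbf{x}_k)\|^2)}{K} \leq O(K^{-4/9}).$$ If $L_g=0$ or $L_f=0$, then the optimal $a$ and $b$ can be chosen to be $a=b=1/2$, yielding $$\frac{\sum_{k=1}^K \mathbb{E}(\|\nabla F(\mathbf{x}_k)\|^2)}{K} \leq O(K^{-1/2}).$$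
   Context: Problem. Consider $\min_{\mathbf{x}\in\mathbb{R}^n} H(\mathbf{x}) := F(\mathbf{x}) + R(\mathbf{x})$ with $F(\mathbf{x})=\mathbb{E}_v(f_v(\mathbb{E}_w(g_w(\mathbf{x}))))$, where $v,w$ are (possibly dependent) random variables, $g_w:\mathbb{R}^n\to\mathbb{R}^m$ and $f_v:\mathbb{R}^m\to\mathbb{R}$ are continuously differentiable, and $R:\mathbb{R}^n\to\mathbb{R}\cup\{+\infty\}$ is a closed convex function. Neither $f_v$ nor $g_w$ is required to be convex or monotone. It is assumed throughout that at least one optimal solution exists. Write $f(\mathbf{y})=\mathbb{E}_v[f_v(\mathbf{y})]$ and $g(\mathbf{x})=\mathbb{E}_w[g_w(\mathbf{x})]$. $\nabla g_w$, $\nabla g$ denote the $m\times n$ Jacobians and $\nabla g_w^\top,\nabla g^\top$ their transposes. ASC-PG algorithm. Given $\mathbf{x}_1\in\mathbb{R}^n$, $\mathbf{y}_1\in\mathbb{R}^m$, and stepsizes $\{\alpha_k\},\{\beta_k\}$, for $k=1,2,\dots$: $$\mathbf{x}_{k+1} = \mathrm{prox}_{\alpha_k R(\cdot)}\left(\mathbf{x}_k-\alpha_k\nabla g_{w_k}^\top(\mathbf{x}_k)\nabla f_{v_k}(\mathbf{y}_k)\right),$$ $$\mathbf{z}_{k+1}=\left(1-\tfrac1{\beta_k}\right)\mathbf{x}_k+\tfrac1{\beta_k}\mathbf{x}_{k+1},\qquad \mathbf{y}_{k+1}=(1-\beta_k)\mathbf{y}_k+\beta_k g_{w_{k+1}}(\mathbf{z}_{k+1}),$$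 where $\mathrm{prox}_{\alpha R(\cdot)}(\mathbf{u})=\arg\min_{\mathbf{x}}\frac12\|\mathbf{x}-\mathbf{u}\|^2+\alpha R(\mathbf{x})$ (the identity map when $R=0$), and the samples $(w_k,v_k)$ are random realizations of $(w,v)$ returned by a sampling oracle, freshly drawn (independent across $k$). Assumptions (those involving random realizations of $v,w$ hold with probability 1): (A1) For all $k$, $\mathbf{x}$, $\mathbf{y}$: $\mathbb{E}_{\{w_k,v_k\}}(\nabla g_{w_k}^\top(\mathbf{x})\nabla f_{v_k}(\mathbf{y}))=\nabla g^\top(\mathbf{x})\nabla f(\mathbf{y})$ and $\mathbb{E}_{w_k}(g_{w_k}(\mathbf{x}))=g(\mathbf{x})$; $w_k$ and $v_k$ are not necessarily independent of each other. (A2) There is $\sigma$ with $\mathbb{E}_w(\|g_w(\mathbf{x})-g(\mathbf{x})\|^2)\le\sigma^2$ for all $\mathbf{x}$. (A3) There is a constant bounding $\|\nabla f_v(\mathbf{y})\|$, $\|\nabla g_w(\mathbf{x})\|$, and the norms of all elements of $\partial R(\mathbf{x})$, for all $\mathbf{x},\mathbf{y},w,v$. (A4) There exist constants $L_F,L_f,L_g\ge 0$ such that for all arguments: (i) $F(\mathbf{z})-F(\mathbf{x})\le\langle\nabla F(\mathbf{x}),\mathbf{z}-\mathbf{x}\rangle+\frac{L_F}{2}\|\mathbf{z}-\mathbf{x}\|^2$; (ii) $\|\nabla f_v(\mathbf{y})-\nabla f_v(\mathbf{y}')\|\le L_f\|\mathbf{y}-\mathbf{y}'\|$ for all $v$;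 (iii) $\|g(\mathbf{x})-g(\mathbf{z})-\nabla g(\mathbf{z})(\mathbf{x}-\mathbf{z})\|\le\frac{L_g}{2}\|\mathbf{x}-\mathbf{z}\|^2$. Notation: $A_K\le O(B_K)$ means there is a constant $c>0$ independent of $K$ with $A_K\le cB_K$ for each $K$. *)

(* Defs.v *)
From HB Require Import structures.
From mathcomp Require Import all_boot all_order all_algebra.
From mathcomp Require Import all_classical all_reals all_analysis.

Set Implicit Arguments.
Unset Strict Implicit.
Unset Printing Implicit Defensive.

Import Order.TTheory GRing.Theory Num.Theory.
Import numFieldNormedType.Exports.

Local Open Scope classical_set_scope.
Local Open Scope ring_scope.

(* Vectors are row vectors.  The library norm on matrices is the sup norm, so
   the Euclidean norm is defined here; on matrices [enorm] is the Frobenius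
   norm. *)
Definition enorm (R : realType) (p q : nat) (M : 'M[R]_(p, q)) : R :=
  Num.sqrt (\sum_i \sum_j M i j ^+ 2).

Definition dotv (R : realType) (p : nat) (u v : 'rV[R]_p) : R :=
  \sum_i u 0 i * v 0 i.

Definition grad (R : realType) (p : nat) (h : 'rV[R]_p -> R) (x : 'rV[R]_p) :
  'rV[R]_p := \row_i 'D_(delta_mx 0 i) h x.

(* The library's ['J g x] acts on row vectors from the right, so it is the
   transpose of the usual m x n Jacobian: with columns turned into rows, the
   product of the usual Jacobian with u is [u *m 'J g x], and the product of its
   transpose with the gradient s is [s *m ('J g x)^T]. *)
Definition chain_grad (R : realType) (n m : nat) (h : 'rV[R]_m -> R)
    (g : 'rV[R]_n -> 'rV[R]_m) (y : 'rV[R]_m) (x : 'rV[R]_n) : 'rV[R]_n :=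
  grad h y *m ('J g x)^T.

Definition C1_real (R : realType) (p : nat) (h : 'rV[R]_p -> R) : Prop :=
  (forall x, differentiable h x) /\ continuous (grad h).

Definition C1_vec (R : realType) (n m : nat) (g : 'rV[R]_n -> 'rV[R]_m) : Prop :=
  (forall x, differentiable g x) /\ continuous (fun x => 'J g x).

(* Convex functions with values in R u {+oo}; "closed" is lower semicontinuity. *)
Definition closed_convex (R : realType) (n : nat) (r : 'rV[R]_n -> \bar R) : Prop :=
  [/\ forall x, r x != -oo%E,
      lower_semicontinuous r &
      forall (x z : 'rV[R]_n) (t : R), 0 <= t <= 1 ->
        (r (t *: x + (1 - t) *: z)%R <= t%:E * r x + (1 - t)%R%:E * r z)%E].

Definition subgradient (R : realType) (n : nat) (r : 'rV[R]_n -> \bar R)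
    (x s : 'rV[R]_n) : Prop :=
  r x \is a fin_num /\ forall z, (r x + (dotv s (z - x)%R)%:E <= r z)%E.

(* [x] minimizes 1/2 |x - u|^2 + alpha r(x). *)
Definition is_prox (R : realType) (n : nat) (alpha : R) (r : 'rV[R]_n -> \bar R)
    (u x : 'rV[R]_n) : Prop :=
  forall z, ((2^-1 * enorm (x - u) ^+ 2)%R%:E + alpha%:E * r x <=
             (2^-1 * enorm (z - u) ^+ 2)%R%:E + alpha%:E * r z)%E.

Definition mutually_independent (d d' : measure_display) (T : measurableType d)
    (S : measurableType d') (R : realType) (P : probability T R)
    (D : set nat) (X : nat -> {RV P >-> S}) : Prop :=
  forall (s : seq nat) (A : nat -> set S),
    uniq s -> [set` s] `<=` D -> (forall k, measurable (A k)) ->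
    P (\bigcap_(k in [set` s]) (X k @^-1` A k)) =
    (\prod_(k <- s) P (X k @^-1` A k))%E.

(* Throughout, [mu] is the joint law of (w, v) on W * V. *)
Definition mean_f (R : realType) (m : nat) (dW dV : measure_display)
    (W : measurableType dW) (V : measurableType dV)
    (mu : probability (W * V)%type R) (fv : V -> 'rV[R]_m -> R)
    (y : 'rV[R]_m) : R :=
  \int[mu]_p fv p.2 y.

Definition mean_g (R : realType) (n m : nat) (dW dV : measure_display)
    (W : measurableType dW) (V : measurableType dV)
    (mu : probability (W * V)%type R) (gw : W -> 'rV[R]_n -> 'rV[R]_m)
    (x : 'rV[R]_n) : 'rV[R]_m :=
  \row_i \int[mu]_p gw p.1 x 0 i.

Definition compF (R : realType) (n m : nat) (dW dV : measure_display)
    (W : measurableType dW) (V : measurableType dV)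
    (mu : probability (W * V)%type R) (fv : V -> 'rV[R]_m -> R)
    (gw : W -> 'rV[R]_n -> 'rV[R]_m) (x : 'rV[R]_n) : R :=
  mean_f mu fv (mean_g mu gw x).

(* Integrability makes the expectations defining f and g meaningful; it
   includes measurability in the random index. *)
Definition composition_problem (R : realType) (n m : nat)
    (dW dV : measure_display) (W : measurableType dW) (V : measurableType dV)
    (mu : probability (W * V)%type R) (fv : V -> 'rV[R]_m -> R)
    (gw : W -> 'rV[R]_n -> 'rV[R]_m) (r : 'rV[R]_n -> \bar R) : Prop :=
  [/\ forall v, C1_real (fv v),
      forall w, C1_vec (gw w),
      forall y, mu.-integrable setT (fun p => (fv p.2 y)%:E),
      forall x i, mu.-integrable setT (fun p => (gw p.1 x 0 i)%:E) &
      closed_convex r] /\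
  (exists xs, forall x, ((compF mu fv gw xs)%:E + r xs <=
                         (compF mu fv gw x)%:E + r x)%E).

(* [xi k] is the pair (w_k, v_k) returned at step k >= 1. *)
Definition sampling_oracle (R : realType) (d dW dV : measure_display)
    (T : measurableType d) (W : measurableType dW) (V : measurableType dV)
    (P : probability T R) (mu : probability (W * V)%type R)
    (xi : nat -> {RV P >-> (W * V)%type}) : Prop :=
  mutually_independent [set k | (0 < k)%N] xi /\
  forall k, (0 < k)%N -> forall A, measurable A -> distribution P (xi k) A = mu A.

Definition unbiased_oracle (R : realType) (n m : nat)
    (d dW dV : measure_display) (T : measurableType d) (W : measurableType dW)
    (V : measurableType dV) (P : probability T R)
    (mu : probability (W * V)%type R) (xi : nat -> {RV P >-> (W * V)%type})
    (fv : V -> 'rV[R]_m -> R) (gw : W -> 'rV[R]_n -> 'rV[R]_m) : Prop :=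
  forall k, (0 < k)%N ->
    (forall x y, \row_i (\int[P]_t
         chain_grad (fv (xi k t).2) (gw (xi k t).1) y x 0 i) =
       chain_grad (mean_f mu fv) (mean_g mu gw) y x) /\
    (forall x, \row_i (\int[P]_t gw (xi k t).1 x 0 i) = mean_g mu gw x).

Definition bounded_variance (R : realType) (n m : nat)
    (dW dV : measure_display) (W : measurableType dW) (V : measurableType dV)
    (mu : probability (W * V)%type R) (gw : W -> 'rV[R]_n -> 'rV[R]_m) : Prop :=
  exists sigma : R, forall x,
    (\int[mu]_p (enorm (gw p.1 x - mean_g mu gw x) ^+ 2)%R%:E <= (sigma ^+ 2)%R%:E)%E.

Definition bounded_gradients (R : realType) (n m : nat)
    (dW dV : measure_display) (W : measurableType dW) (V : measurableType dV)
    (mu : probability (W * V)%type R) (fv : V -> 'rV[R]_m -> R)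
    (gw : W -> 'rV[R]_n -> 'rV[R]_m) (r : 'rV[R]_n -> \bar R) : Prop :=
  exists C : R,
    [/\ {ae mu, forall p, forall y, enorm (grad (fv p.2) y) <= C},
        {ae mu, forall p, forall x, enorm ('J (gw p.1) x) <= C} &
        forall x s, subgradient r x s -> enorm s <= C].

Definition smoothness (R : realType) (n m : nat)
    (dW dV : measure_display) (W : measurableType dW) (V : measurableType dV)
    (mu : probability (W * V)%type R) (fv : V -> 'rV[R]_m -> R)
    (gw : W -> 'rV[R]_n -> 'rV[R]_m) (LF Lf Lg : R) : Prop :=
  let F := compF mu fv gw in
  let g := mean_g mu gw in
  [/\ forall x z, F z - F x <=
        dotv (grad F x) (z - x) + LF / 2 * enorm (z - x) ^+ 2,
      {ae mu, forall p, forall y y',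
        enorm (grad (fv p.2) y - grad (fv p.2) y') <= Lf * enorm (y - y')} &
      forall x z, enorm (g x - g z - (x - z) *m 'J g z) <=
        Lg / 2 * enorm (x - z) ^+ 2].

(* The sequences start at index 1 (and z at index 2); earlier values are
   irrelevant. *)
Definition asc_pg (R : realType) (n m : nat) (d dW dV : measure_display)
    (T : measurableType d) (W : measurableType dW) (V : measurableType dV)
    (P : probability T R) (xi : nat -> {RV P >-> (W * V)%type})
    (fv : V -> 'rV[R]_m -> R) (gw : W -> 'rV[R]_n -> 'rV[R]_m)
    (r : 'rV[R]_n -> \bar R) (alpha beta : nat -> R)
    (x1 : 'rV[R]_n) (y1 : 'rV[R]_m)
    (x z : nat -> T -> 'rV[R]_n) (y : nat -> T -> 'rV[R]_m) : Prop :=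
  (forall t, x 1%N t = x1 /\ y 1%N t = y1) /\
  forall k t, (0 < k)%N ->
    [/\ is_prox (alpha k) r
          (x k t - alpha k *:
             chain_grad (fv (xi k t).2) (gw (xi k t).1) (y k t) (x k t))
          (x k.+1 t),
        z k.+1 t = (1 - (beta k)^-1) *: x k t + (beta k)^-1 *: x k.+1 t &
        y k.+1 t = (1 - beta k) *: y k t +
                   beta k *: gw (xi k.+1 t).1 (z k.+1 t)].

Definition avg_sq_grad (R : realType) (n : nat) (d : measure_display)
    (T : measurableType d) (P : probability T R) (F : 'rV[R]_n -> R)
    (x : nat -> T -> 'rV[R]_n) (K : nat) : \bar R :=
  ((K%:R^-1)%:E *
   \sum_(1 <= k < K.+1) 'E_P[fun t => (enorm (grad F (x k t)) ^+ 2)%R])%E.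

Definition le_bigO (R : realType) (A : nat -> \bar R) (B : nat -> R) : Prop :=
  exists2 c : R, 0 < c & forall K, (0 < K)%N -> (A K <= (c * B K)%R%:E)%E.

Definition log_factor (R : realType) (a b : R) (K : nat) : R :=
  if 4 * a - 4 * b == 1 then ln K%:R else 1.

Definition rate (R : realType) (Lf Lg a b : R) (K : nat) : R :=
  K%:R `^ (a - 1) + Lf ^+ 2 * Lg * K%:R `^ (4 * b - 4 * a) * log_factor a b K +
  Lf ^+ 2 * K%:R `^ (- b) + K%:R `^ (- a).

(* Main.v *)
Require Import Defs.
From HB Require Import structures.
From mathcomp Require Import all_boot all_order all_algebra.
From mathcomp Require Import all_classical all_reals all_analysis.
From mathcomp Require Import measurable_realfun ring lra.
Import Order.TTheory GRing.Theory Num.Theory.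
Import numFieldNormedType.Exports.
Local Open Scope classical_set_scope.
Local Open Scope ring_scope.

Set Implicit Arguments.
Unset Strict Implicit.

(* Let e_k = y_k - g(x_k).  Since x_(k+1) = (1 - beta_k) x_k + beta_k z_(k+1),
   the first-order parts of g cancel in e_(k+1) - (1 - beta_k) e_k, which leaves
   a drift O(Lg alpha_k^2 / beta_k) and beta_k times a centered noise that is
   independent of the past.  Hence
     E|e_(k+1)|^2 <= (1 - beta_k) E|e_k|^2 + O(Lg^2 alpha_k^4 / beta_k^3 + beta_k^2),
   so that E|e_k|^2 = O(Lg k^(4b - 4a) + k^(-b)).  The descent inequality for F
   gives
     E|grad F(x_k)|^2 <= (2 / alpha_k) E(F(x_k) - F(x_(k+1)))
                         + O(Lf^2 E|e_k|^2 + alpha_k),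
   and Abel summation bounds the average.  The iterate y_k depends on the sample
   xi_k that is also used in the gradient step, so the gradient step is not
   conditionally unbiased; but replacing y_k by g(x_k), which only depends on
   earlier samples, costs at most Lf C |e_k| pathwise.
   When 4b - 4a <= a - 1 the term k^(4b - 4a) is dominated by k^(a - 1), so the
   logarithmic factor is never needed. *)

(** * Powers of the stepsizes *)

(** Only the samples [fv v] and [gw w] are assumed differentiable; differentiability of f, g and F
    has to be recovered. A map with a quadratic remainder is differentiable: (A4)(iii) is such a
    bound for g, and for f the sample remainders, bounded uniformly in v, are integrated.
    Conditional expectations are replaced by Fubini: the probability space with the sigma-algebra of
    the first k samples is one factor, the law of the new sample the other, so that whatever the
    past determines is constant in the inner integral. This needs joint measurability in sample and
    point, obtained from continuity in the point. The bounds of (A3) control the moves of x_k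
    pathwise, but g_w has only bounded variance, so E|e_k|^2 < oo is itself proved by induction,
    from a recursion first stated for extended-real integrals. The power beta_k^(-3) comes from
    convexity of the squared norm: (1 - beta) e + beta (drift / beta) keeps the contraction 1 - beta
    exactly and turns drift^2 into drift^2 / beta. *)

Lemma natr_powRD (R : realType) (k : nat) (r s : R) : (0 < k)%N ->
  k%:R `^ (r + s) = k%:R `^ r * k%:R `^ s.
Proof. by move=> k0; rewrite powRD// pnatr_eq0 -lt0n k0 implybT. Qed.

Lemma powR_nat_unbounded (R : realType) (p A : R) : 0 < p ->
  exists k0 : nat, forall k, (k0 <= k)%N -> A <= k%:R `^ p.
Proof.
move=> p0; exists (Num.truncn (`|A| `^ p^-1)).+1 => k kk0.
have kA : `|A| `^ p^-1 <= k%:R.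
  by apply/ltW/(lt_le_trans (truncnS_gt _)); rewrite ler_nat.
apply: (le_trans (ler_norm A)).
rewrite -[leLHS]powRr1// -[X in _ `^ X](mulVf (lt0r_neq0 p0)) powRrM.
by apply: ge0_ler_powR => //; rewrite ?ltW// nnegrE ?powR_ge0.
Qed.

(** One step changes k^s by a relative amount of at most |s|/k, which k^(-b) eventually dominates.
    For s < 0, (1 + 1/k)^s = exp(s ln(1 + 1/k)) >= 1 + s ln(1 + 1/k) >= 1 + s/k. *)
Lemma powR_succ_ge (R : realType) (s : R) (k : nat) : (0 < k)%N ->
  k%:R `^ s * (1 - `|s| / k%:R) <= k.+1%:R `^ s.
Proof.
move=> k0; have kR : 0 < k%:R :> R by rewrite ltr0n.
have [s0|s0] := leP 0 s.
  apply: (@le_trans _ _ (k%:R `^ s)).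
    rewrite ler_piMr ?powR_ge0// gerBl divr_ge0//.
  by apply: ge0_ler_powR; rewrite ?nnegrE// ler_nat.
have k1 : 0 < 1 + k%:R^-1 :> R by rewrite addr_gt0 ?invr_gt0.
have -> : k.+1%:R = k%:R * (1 + k%:R^-1) :> R.
  by rewrite mulrDr mulr1 mulfV ?gt_eqF// -natr1.
rewrite powRM ?(ltW kR) ?(ltW k1)//.
rewrite ler_wpM2l ?powR_ge0//.
rewrite ltr0_norm// mulNr opprK /powR gt_eqF//.
apply: le_trans (expR_ge1Dx _); rewrite lerD2l.
rewrite ler_wnM2l ?(ltW s0)//.
by apply: le_ln1Dx; rewrite (lt_trans (ltrN10 _))// invr_gt0.
Qed.

(** Induction on K. The constant is 1/p, the one of the integral comparison, enlarged by 1 to leave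
    room for the elementary bound on (k-1)^p. *)
Lemma sum_powR_le (R : realType) (p : R) (K : nat) : 0 < p <= 1 -> (0 < K)%N ->
  \sum_(1 <= k < K.+1) k%:R `^ (p - 1) <= (1 + p) / p * K%:R `^ p.
Proof.
move=> /andP[p0 p1]; elim: K => // -[_ _|K IH _].
  by rewrite big_nat1 !powR1 mulr1 ler_pdivlMr// mul1r lerDr.
rewrite big_nat_recr//=.
have {}IH := IH isT.
apply: (le_trans (lerD IH (lexx _))).
have kR : 0 < K.+2%:R :> R by rewrite ltr0n.
have jR : 0 < K.+1%:R :> R by rewrite ltr0n.
have k1 : K.+2%:R = K.+1%:R + 1 :> R by rewrite natr1.
(* (k-1)^p <= k^p / (1 + p/k), from exp(-p log(1 - 1/k)) >= 1 + p/k *)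
have h : K.+1%:R `^ p * (1 + p / K.+2%:R) <= K.+2%:R `^ p.
  have -> : K.+1%:R = K.+2%:R * (1 + - K.+2%:R^-1) :> R.
    by rewrite mulrDr mulr1 mulrN mulfV ?gt_eqF// k1 addrK.
  have q0 : 0 < 1 + - K.+2%:R^-1 :> R.
    by rewrite subr_gt0 invf_lt1// ltr1n.
  rewrite powRM ?(ltW q0) ?(ltW kR)// -mulrA. rewrite ler_piMr ?powR_ge0//.
  rewrite -[leRHS](expRxMexpNx_1 (p * ln (1 + - K.+2%:R^-1))).
  rewrite /powR gt_eqF// ler_pM2l ?expR_gt0//.
  apply: le_trans (expR_ge1Dx _); rewrite lerD2l -mulrN ler_pM2l//.
  rewrite lerNr; apply: le_ln1Dx.
  by rewrite ltrN2 invf_lt1// ltr1n.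
have e : K.+2%:R `^ p = K.+2%:R * K.+2%:R `^ (p - 1) :> R.
  by rewrite mulr_powRB1// ltW.
move: h; rewrite e; set u := K.+1%:R `^ p; set v := K.+2%:R `^ (p - 1).
move: kR; set k := K.+2%:R => kR h.
have v0 : 0 <= v by exact: powR_ge0.
have k2 : 1 <= k by rewrite /k k1 lerDr ler0n.
have h' : u * (k + p) <= k * v * k.
  by rewrite -ler_pdivrMr// -mulrA mulrDl divff ?gt_eqF.
have p1' : 0 < 1 + p by rewrite addr_gt0.
(* This is exactly what the induction step requires; it follows from [h'] because k / (k + p) >= 1 /
   (1 + p) for k >= 1. *)
have hu : u <= k * v - p / (1 + p) * v.
  rewrite -(ler_pM2r (addr_gt0 kR p0)) (le_trans h')// -subr_ge0.
  have -> : (k * v - p / (1 + p) * v) * (k + p) - k * v * k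
      = v * (p ^+ 2) * (k - 1) / (1 + p).
    by field; rewrite gt_eqF.
  by rewrite !mulr_ge0 ?subr_ge0 ?invr_ge0 ?exprn_ge0// ltW.
have c0 : 0 <= (1 + p) / p by rewrite divr_ge0// ltW.
apply: (le_trans (lerD (ler_wpM2l c0 hu) (lexx v))).
by rewrite le_eqVlt; apply/orP; left; apply/eqP; field; rewrite !gt_eqF.
Qed.

(** The constant adds up those of two cases: 1 for s >= 0, where every term is at most K^s, and (2 +
    s) / (1 + s) for s < 0, which is [sum_powR_le] at p = s + 1. *)
Lemma le_sum_powR (R : realType) (s : R) (K : nat) : -1 < s -> (0 < K)%N ->
  \sum_(1 <= k < K.+1) k%:R `^ s <= (1 + (2 + s) / (1 + s)) * K%:R `^ (s + 1).
Proof.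
move=> s1 K0; have s0 : 0 < s + 1 by rewrite -ltrBlDr sub0r.
have [sp|sn] := leP 0 s.
  apply: (@le_trans _ _ (\sum_(1 <= k < K.+1) K%:R `^ s)).
    rewrite !big_nat ler_sum// => k /andP[k1 kK].
    by apply: ge0_ler_powR; rewrite ?nnegrE// ler_nat.
  rewrite sumr_const_nat subSS subn0 -[leLHS]mulr_natl.
  rewrite [leRHS]mulrC natr_powRD//.
  rewrite powRr1// [leLHS]mulrC ler_peMr ?mulr_ge0 ?powR_ge0// lerDl.
  by rewrite divr_ge0 ?addr_ge0.
have := @sum_powR_le R (s + 1) K _ K0; rewrite addrK => /(_ _)/le_trans; apply.
  by rewrite s0/= -lerBrDr subrr ltW.
rewrite ler_wpM2r ?powR_ge0// (_ : 1 + (s + 1) = 2 + s); last by ring.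
by rewrite [s + 1]addrC lerDr.
Qed.

(* The stepsizes k^(-b), b < 1, decay slower than 1/k, so any power k^s is
   an approximate fixed point of the recursion. *)
Lemma recursion_powR_le (R : realType) (b s1 s2 C1 C2 : R) (u : nat -> R) :
  0 < b < 1 -> 0 <= C1 -> 0 <= C2 -> (forall k, 0 <= u k) ->
  (forall k, (0 < k)%N -> 2 * k%:R `^ (- b) <= 1 ->
     u k.+1 <= (1 - 2 * k%:R `^ (- b)) * u k +
               k%:R `^ (- b) * (C1 * k%:R `^ s1 + C2 * k%:R `^ s2)) ->
  exists2 D : R, 0 <= D & forall k, (0 < k)%N ->
     u k <= C1 * k%:R `^ s1 + D * k%:R `^ s2.
Proof.
move=> /andP[b0 b1] C10 C20 u0 hu.
have [k1 hk1] := @powR_nat_unbounded R b 2 b0.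
have b1' : 0 < 1 - b by rewrite subr_gt0.
have [k2 hk2] := @powR_nat_unbounded R (1 - b) (`|s1| + `|s2|) b1'.
(* Beyond [k0] both 2 k^(-b) <= 1 and (|s1| + |s2|) / k <= k^(-b) hold; the successor keeps the
   indices positive. *)
pose k0 := (maxn k1 k2).+1.
pose S := \sum_(1 <= j < k0.+1) u j / j%:R `^ s2.
have S0 : 0 <= S by apply: sumr_ge0 => j _; rewrite divr_ge0 ?powR_ge0.
(* [S] absorbs the finitely many initial values. They are charged to k^s2 alone: [C1] must stay
   untouched, since in the application it carries the factor Lg of the rate. *)
exists (C2 + S) => [|k k_gt0]; first exact: addr_ge0.
have small j : (0 < j <= k0)%N -> u j <= C1 * j%:R `^ s1 + (C2 + S) * j%:R `^ s2.
  move=> /andP[j0 jk].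
  have h : u j / j%:R `^ s2 <= S.
    have jI : j \in index_iota 1 k0.+1 by rewrite mem_index_iota j0 ltnS.
    rewrite /S (bigD1_seq j jI (iota_uniq _ _))/=.
    by rewrite lerDl sumr_ge0// => i _; rewrite divr_ge0 ?powR_ge0.
  move: h; rewrite ler_pdivrMr ?powR_gt0 ?ltr0n// => /le_trans; apply.
  by rewrite mulrDl addrA lerDr addr_ge0// mulr_ge0 ?powR_ge0.
have [kk0|] := leqP k k0; first by rewrite small// k_gt0.
move=> k0k; move: (ltnW k0k) => {k_gt0}{}k0k.
rewrite -(subnK k0k); elim: (k - k0)%N => [|j]; first by rewrite small ?leqnn.
rewrite addSn; set i := (j + k0)%N => IH.
have i0 : (0 < i)%N by rewrite /i addnS.
have iR : 0 < i%:R :> R by rewrite ltr0n.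
have k1i : (k1 <= i)%N.
  by rewrite (leq_trans (leq_maxl k1 k2))// (leq_trans (leqnSn _))// leq_addl.
have k2i : (k2 <= i)%N.
  by rewrite (leq_trans (leq_maxr k1 k2))// (leq_trans (leqnSn _))// leq_addl.
have bi : 2 * i%:R `^ (- b) <= 1.
  by rewrite powRN ler_pdivrMr ?powR_gt0// mul1r hk1.
have si (s : R) : `|s| <= `|s1| + `|s2| ->
    i%:R `^ s * (1 - i%:R `^ (- b)) <= i.+1%:R `^ s.
  move=> ss; apply: (le_trans _ (powR_succ_ge s i0)).
  rewrite ler_wpM2l ?powR_ge0// lerD2l lerN2 ler_pdivrMr//.
  apply: (le_trans ss). apply: (le_trans (hk2 _ k2i)).
  by rewrite addrC natr_powRD// powRr1.
(* With q = i^(-b), the contraction 1 - 2q is spent twice: one q balances the forcing term, the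
   other pays for passing from i^s to (i+1)^s. The slack is S q i^s2. *)
apply: (le_trans (hu _ i0 bi)).
have h1 : i%:R `^ s1 * (1 - i%:R `^ (- b)) <= i.+1%:R `^ s1 by rewrite si ?lerDl.
have h2 : i%:R `^ s2 * (1 - i%:R `^ (- b)) <= i.+1%:R `^ s2 by rewrite si ?lerDr.
have := ler_wpM2l C10 h1.
have := ler_wpM2l (addr_ge0 C20 S0) h2.
have b1i : 0 <= 1 - 2 * i%:R `^ (- b) by rewrite subr_ge0.
have := ler_wpM2l b1i IH.
have S2 : 0 <= S * (i%:R `^ (- b) * i%:R `^ s2).
  by rewrite !mulr_ge0 ?powR_ge0.
move: S2; lra.
Qed.

(** Abel summation by induction: raising the weight from K^a to (K+1)^a is paid by M - F (K+1) >= 0.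
    This is where the uniform upper bound on E F(x_k) enters. *)
Lemma weighted_telescope_le (R : realType) (a M : R) (F : nat -> R) (K : nat) :
  0 <= a -> (forall k, (0 < k)%N -> F k <= M) ->
  \sum_(1 <= k < K.+1) k%:R `^ a * (F k - F k.+1) <= K%:R `^ a * (M - F K.+1).
Proof.
move=> a0 FM; elim: K => [|K IH].
  by rewrite big_nil mulr_ge0 ?powR_ge0// subr_ge0 FM.
rewrite big_nat_recr//=; apply: (le_trans (lerD IH (lexx _))).
have h : K%:R `^ a <= K.+1%:R `^ a :> R.
  by apply: ge0_ler_powR; rewrite ?nnegrE// ler_nat.
have := ler_wpM2r (_ : 0 <= M - F K.+1) h.
by rewrite subr_ge0 FM// => /(_ isT); lra.
Qed.

(** * Averages of powers and the rate *)

Lemma avg_powR_le (R : realType) (s : R) : -1 < s ->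
  exists2 c : R, 0 <= c & forall K, (0 < K)%N ->
    K%:R^-1 * \sum_(1 <= k < K.+1) k%:R `^ s <= c * K%:R `^ s.
Proof.
move=> s1; have s10 : 0 < 1 + s by rewrite -ltrBlDl sub0r.
exists (1 + (2 + s) / (1 + s)) => [|K K0].
  by rewrite addr_ge0// divr_ge0 ?ltW// -[2]/(1 + 1) -addrA addr_gt0.
rewrite ler_pdivrMl ?ltr0n// (le_trans (le_sum_powR s1 K0))//.
by rewrite natr_powRD// powRr1// [leLHS]mulrA [leLHS]mulrC.
Qed.

Lemma log_factor_ge0 (R : realType) (a b : R) (K : nat) : (0 < K)%N ->
  0 <= log_factor a b K.
Proof. by move=> K0; rewrite /log_factor; case: ifP => // _; rewrite ln_ge0// ler1n. Qed.

(** When 4a - 4b = 1 the logarithm vanishes at K = 1, so the second term alone could not bound the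
    average for every K; K^(a - 1) covers this case. *)
Lemma avg_powR_le_log (R : realType) (a b : R) : 0 < a < 1 ->
  exists2 c : R, 0 <= c & forall K, (0 < K)%N ->
    K%:R^-1 * \sum_(1 <= k < K.+1) k%:R `^ (4 * b - 4 * a) <=
    c * (K%:R `^ (a - 1) + K%:R `^ (4 * b - 4 * a) * log_factor a b K).
Proof.
move=> /andP[a0 a1]; set s := 4 * b - 4 * a.
have [sa|sa] := leP s (a - 1).
  have [|c c0 hc] := @avg_powR_le R (a - 1); first by rewrite ltrBrDr addNr.
  exists c => // K K0.
  apply: (@le_trans _ _ (c * K%:R `^ (a - 1))); last first.
    by rewrite ler_wpM2l// lerDl mulr_ge0 ?powR_ge0// log_factor_ge0.
  apply: le_trans (hc K K0); rewrite ler_wpM2l ?invr_ge0//.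
  rewrite !big_nat; apply: ler_sum => k /andP[k1 _].
  by apply: ler_powR => //; rewrite ler1n.
(* Here s > a - 1 > -1, so s = -1 is excluded and [log_factor] is 1. *)
have [|c c0 hc] := @avg_powR_le R s.
  by rewrite (lt_trans _ sa)// ltrBrDr addNr.
exists c => // K K0; apply: (le_trans (hc K K0)).
rewrite ler_wpM2l// /log_factor ifN ?mulr1 ?lerDr ?powR_ge0//.
by apply/eqP => e; move: sa; rewrite /s; move: e a0; clear; lra.
Qed.

Lemma avg_rate_le (R : realType) (a b Lf Lg D1 D2 D3 Fmin M : R)
    (F G : nat -> R) :
  0 < a < 1 -> 0 < b < 1 -> 0 <= Lg ->
  0 <= D1 -> 0 <= D2 -> 0 <= D3 ->
  (forall k, (0 < k)%N -> Fmin <= F k <= M) ->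
  (forall k, (0 < k)%N ->
     G k <= 2 * (k%:R `^ a * (F k - F k.+1)) +
            Lf ^+ 2 * (D1 * (Lg * k%:R `^ (4 * b - 4 * a)) + D2 * k%:R `^ (- b)) +
            D3 * k%:R `^ (- a)) ->
  exists2 c : R, 0 < c & forall K, (0 < K)%N ->
    K%:R^-1 * \sum_(1 <= k < K.+1) G k <= c * rate Lf Lg a b K.
Proof.
move=> a01 /andP[b0 b1] Lg0 D10 D20 D30 hF hG.
have [a0 a1] := andP a01.
have [c1 c10 h1] := avg_powR_le_log b a01.
have [|c2 c20 h2] := @avg_powR_le R (- b); first by rewrite ltrN2.
have [|c3 c30 h3] := @avg_powR_le R (- a); first by rewrite ltrN2.
have MF0 : 0 <= M - Fmin.
  by rewrite subr_ge0; have /andP[/le_trans] := hF 1%N isT; apply.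
have C0 : 0 <= Lf ^+ 2 * D1 * Lg * c1.
  by rewrite mulr_ge0// mulr_ge0// mulr_ge0// sqr_ge0.
(* The bracket multiplies K^(a - 1): the telescoped sum contributes the first part, and the second
   is the share of the sum of k^s that [avg_powR_le_log] charges to K^(a - 1). The 1 makes [c]
   positive. *)
pose c := 1 + (2 * (M - Fmin) + Lf ^+ 2 * D1 * Lg * c1) + D1 * c1 + D2 * c2 + D3 * c3.
exists c.
  by rewrite /c -!addrA ltr_wpDr ?ltr01// !addr_ge0// mulr_ge0.
move=> K K0.
have KR : 0 < K%:R :> R by rewrite ltr0n.
set s := 4 * b - 4 * a in hG h1 *.
have -> : rate Lf Lg a b K = K%:R `^ (a - 1) + Lf ^+ 2 * Lg * (K%:R `^ s * log_factor a b K)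
   + Lf ^+ 2 * K%:R `^ (- b) + K%:R `^ (- a).
  by rewrite /rate -/s !mulrA.
have hs : K%:R^-1 * \sum_(1 <= k < K.+1) G k <=
    2 * (K%:R^-1 * \sum_(1 <= k < K.+1) (k%:R `^ a * (F k - F k.+1))) +
    Lf ^+ 2 * (D1 * (Lg * (K%:R^-1 * \sum_(1 <= k < K.+1) k%:R `^ s)) +
       D2 * (K%:R^-1 * \sum_(1 <= k < K.+1) k%:R `^ (- b))) +
    D3 * (K%:R^-1 * \sum_(1 <= k < K.+1) k%:R `^ (- a)).
  have hs0 : \sum_(1 <= k < K.+1) G k <= \sum_(1 <= k < K.+1)
      (2 * (k%:R `^ a * (F k - F k.+1)) +
       Lf ^+ 2 * (D1 * (Lg * k%:R `^ s) + D2 * k%:R `^ (- b)) +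
       D3 * k%:R `^ (- a)).
    by rewrite !big_nat; apply: ler_sum => k /andP[k0 _]; exact: hG.
  have Ki : 0 <= K%:R^-1 :> R by rewrite invr_ge0.
  apply: (le_trans (ler_wpM2l Ki hs0)).
  rewrite 2!big_split/= -!mulr_sumr big_split/= -!mulr_sumr.
  by rewrite le_eqVlt; apply/orP; left; apply/eqP; ring.
apply: (le_trans hs).
have htel : K%:R^-1 * \sum_(1 <= k < K.+1) (k%:R `^ a * (F k - F k.+1)) <=
    (M - Fmin) * K%:R `^ (a - 1).
  have FM k : (0 < k)%N -> F k <= M by move=> /hF/andP[].
  rewrite ler_pdivrMl//; apply: (le_trans (weighted_telescope_le K (ltW a0) FM)).
  rewrite [leRHS]mulrCA mulr_powRB1// [leLHS]mulrC ler_wpM2r ?powR_ge0// lerD2l lerN2.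
  by have /andP[] := hF K.+1 isT.
have {}h1 := h1 K K0; have {}h2 := h2 K K0; have {}h3 := h3 K K0.
have p1 : 0 <= K%:R `^ (a - 1) :> R by exact: powR_ge0.
have p2 : 0 <= K%:R `^ s * log_factor a b K by rewrite mulr_ge0 ?powR_ge0 ?log_factor_ge0.
have p3 : 0 <= K%:R `^ (- b) :> R by exact: powR_ge0.
have p4 : 0 <= K%:R `^ (- a) :> R by exact: powR_ge0.
move: htel h1 h2 h3 p1 p2 p3 p4.
move: (K%:R^-1 * \sum_(1 <= k < K.+1) (k%:R `^ a * (F k - F k.+1))) => T0.
move: (K%:R^-1 * \sum_(1 <= k < K.+1) k%:R `^ s) => T1.
move: (K%:R^-1 * \sum_(1 <= k < K.+1) k%:R `^ (- b)) => T2.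
move: (K%:R^-1 * \sum_(1 <= k < K.+1) k%:R `^ (- a)) => T3.
move: (K%:R `^ (a - 1)) (K%:R `^ s * _) (K%:R `^ (- b)) (K%:R `^ (- a)).
move=> q1 q2 q3 q4 h0 h1 h2 h3 p1 p2 p3 p4.
have L2 : 0 <= Lf ^+ 2 by rewrite sqr_ge0.
have B : 2 * T0 + Lf ^+ 2 * (D1 * (Lg * T1) + D2 * T2) + D3 * T3 <=
   (2 * (M - Fmin) + Lf ^+ 2 * D1 * Lg * c1) * q1 + D1 * c1 * (Lf ^+ 2 * Lg * q2)
   + D2 * c2 * (Lf ^+ 2 * q3) + D3 * c3 * q4.
  have i1 := ler_wpM2l (mulr_ge0 (mulr_ge0 L2 D10) Lg0) h1.
  have i2 := ler_wpM2l (mulr_ge0 L2 D20) h2.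
  have i3 := ler_wpM2l D30 h3.
  move: i1 i2 i3 h0; lra.
apply: (le_trans B).
have e1 : 0 <= 2 * (M - Fmin) + Lf ^+ 2 * D1 * Lg * c1 by rewrite addr_ge0// mulr_ge0.
have e2 : 0 <= D1 * c1 by rewrite mulr_ge0.
have e3 : 0 <= D2 * c2 by rewrite mulr_ge0.
have e4 : 0 <= D3 * c3 by rewrite mulr_ge0.
have r2 : 0 <= Lf ^+ 2 * Lg * q2 by rewrite mulr_ge0// mulr_ge0.
have r3 : 0 <= Lf ^+ 2 * q3 by rewrite mulr_ge0.
rewrite [leRHS]mulrDr [X in _ <= X + _]mulrDr [X in _ <= X + _ + _]mulrDr /c.
by rewrite !lerD// ler_wpM2r//; move: e1 e2 e3 e4; clear; lra.
Qed.

(** [e] is an exponent dominating all the terms present; the disjunction drops the exponent 4b - 4a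
    when its coefficient vanishes. *)
Lemma rate_const_le (R : realType) (Lf Lg a b e : R) (K : nat) : (0 < K)%N ->
  4 * a - 4 * b != 1 -> 0 <= Lf ^+ 2 * Lg ->
  a - 1 <= e -> (Lf ^+ 2 * Lg = 0 \/ 4 * b - 4 * a <= e) -> - b <= e -> - a <= e ->
  rate Lf Lg a b K <= (2 + Lf ^+ 2 * Lg + Lf ^+ 2) * K%:R `^ e.
Proof.
move=> K0 ab L0 h1 h2 h3 h4.
have K1 : 1 <= K%:R :> R by rewrite ler1n.
rewrite /rate /log_factor (negbTE ab) mulr1.
have L2 : 0 <= Lf ^+ 2 by rewrite sqr_ge0.
have i1 := ler_powR K1 h1.
have i2 : Lf ^+ 2 * Lg * K%:R `^ (4 * b - 4 * a) <= Lf ^+ 2 * Lg * K%:R `^ e.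
  by case: h2 => [->|h2]; rewrite ?mul0r// ler_wpM2l// ler_powR.
have i3 := ler_wpM2l L2 (ler_powR K1 h3).
have i4 := ler_powR K1 h4.
by move: i1 i2 i3 i4; lra.
Qed.

(** Whatever a is, one of a - 1 and -a is at least -1/2. Hence no choice of exponents brings the
    bound [rate] below K^(-1/2), which is the optimality of a = b = 1/2. *)
Lemma half_rate_le (R : realType) (Lf Lg a b : R) (K : nat) : (0 < K)%N ->
  0 <= Lg -> K%:R `^ (- (1 / 2)) <= rate Lf Lg a b K.
Proof.
move=> K0 Lg0; have K1 : 1 <= K%:R :> R by rewrite ler1n.
have h3 : 0 <= Lf ^+ 2 * K%:R `^ (- b) by rewrite mulr_ge0 ?sqr_ge0 ?powR_ge0.
have h2 : 0 <= Lf ^+ 2 * Lg * K%:R `^ (4 * b - 4 * a) * log_factor a b K.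
  by rewrite mulr_ge0 ?log_factor_ge0// mulr_ge0 ?powR_ge0// mulr_ge0// sqr_ge0.
have h1 : 0 <= K%:R `^ (a - 1) :> R by exact: powR_ge0.
have h4 : 0 <= K%:R `^ (- a) :> R by exact: powR_ge0.
rewrite /rate; have [ha|ha] := leP a (1 / 2).
  have : - (1 / 2) <= - a by rewrite lerN2.
  by move/(ler_powR K1) => ?; lra.
have : - (1 / 2) <= a - 1 by lra.
by move/(ler_powR K1) => ?; lra.
Qed.

(** Puts the drift term alpha^4 / beta^3 in the form k^(-b) times a power that [recursion_powR_le]
    expects. *)
Lemma powR_step_ratio {R : realType} (a b : R) (k : nat) : (0 < k)%N ->
  (k%:R `^ (- a)) ^+ 4 / (k%:R `^ (- b)) ^+ 3 =
  k%:R `^ (- b) * k%:R `^ (4 * b - 4 * a) :> R.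
Proof.
move=> k0; have kR : 0 < k%:R :> R by rewrite ltr0n.
have e4 r : k%:R `^ (r * 4) = (k%:R `^ r) ^+ 4 :> R.
  by rewrite powRrM powR_mulrn// powR_ge0.
have -> : 4 * b - 4 * a = - a * 4 - (- b * 4) by ring.
rewrite powRB; last by rewrite (gt_eqF kR) implybT.
rewrite !e4; move: (powR_gt0 (- b) kR); move: (k%:R `^ (- b)) => q q0.
by field; rewrite gt_eqF.
Qed.

(** Here a is the stepsize, d and D the inner products of grad F with the actual step direction and
    with the one evaluated at g(x_k), p = |grad F|^2, k the squared bound on the difference of the
    two directions, and S <= q their squared length bound. *)
Lemma descent_pointwise {R : realType} (a F1 F2 d D p k q LF S : R) :
  0 < a -> 0 <= LF ->
  F2 - F1 <= - (a * d) + LF / 2 * (a ^+ 2 * S) ->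
  D - d <= (p + k) / 2 -> S <= q ->
  F2 <= F1 - a * D + a / 2 * p + a / 2 * k + LF / 2 * a ^+ 2 * q.
Proof.
move=> a0 LF0 hF hD hS.
have h1 := ler_wpM2l (ltW a0) hD.
have LFa : 0 <= LF / 2 * a ^+ 2 by rewrite mulr_ge0 ?sqr_ge0// divr_ge0.
have h2 := ler_wpM2l LFa hS.
move: hF h1 h2; move: (a ^+ 2) => a2; lra.
Qed.

(** Young's inequality returns only half of a * G, so the other half survives and can be
    isolated. *)
Lemma descent_rearrange {R : realType} (a G F1 F2 K q : R) : 0 < a ->
  F2 <= F1 - a * G + a / 2 * G + a / 2 * K + q / 2 * a ^+ 2 ->
  G <= 2 / a * (F1 - F2) + K + q * a.
Proof.
move=> a0 h; rewrite -(ler_pM2l a0).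
have -> : a * (2 / a * (F1 - F2) + K + q * a) = 2 * (F1 - F2) + a * K + q * a ^+ 2.
  by field; rewrite gt_eqF.
by move: h; move: (a ^+ 2) => a2; lra.
Qed.

Lemma mul_le_half_sqrD {R : realType} (p q : R) : p * q <= (p ^+ 2 + q ^+ 2) / 2.
Proof. by have := sqr_ge0 (p - q); lra. Qed.

(** * Euclidean norm *)

Section euclidean_norm.
Context {R : realType}.
Implicit Types p q s : nat.

Lemma enorm_ge0 p q (M : 'M[R]_(p, q)) : 0 <= enorm M.
Proof. exact: sqrtr_ge0. Qed.

Lemma sqr_enormE p q (M : 'M[R]_(p, q)) :
  enorm M ^+ 2 = \sum_i \sum_j M i j ^+ 2.
Proof.
rewrite sqr_sqrtr// sumr_ge0// => i _; rewrite sumr_ge0// => j _.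
exact: sqr_ge0.
Qed.

Lemma dotvC p (u v : 'rV[R]_p) : dotv u v = dotv v u.
Proof. by apply: eq_bigr => i _; rewrite mulrC. Qed.

Lemma dotvDr p (u v w : 'rV[R]_p) : dotv u (v + w) = dotv u v + dotv u w.
Proof. by rewrite -big_split; apply: eq_bigr => i _; rewrite mxE mulrDr. Qed.

Lemma dotvZr p a (u v : 'rV[R]_p) : dotv u (a *: v) = a * dotv u v.
Proof. by rewrite mulr_sumr; apply: eq_bigr => i _; rewrite mxE mulrCA. Qed.

Lemma dotvNr p (u v : 'rV[R]_p) : dotv u (- v) = - dotv u v.
Proof. by rewrite -scaleN1r dotvZr mulN1r. Qed.

Lemma dotvBr p (u v w : 'rV[R]_p) : dotv u (v - w) = dotv u v - dotv u w.
Proof. by rewrite dotvDr dotvNr. Qed.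

Lemma dotvDl p (u v w : 'rV[R]_p) : dotv (u + v) w = dotv u w + dotv v w.
Proof. by rewrite dotvC dotvDr !(dotvC w). Qed.

Lemma dotvZl p a (u v : 'rV[R]_p) : dotv (a *: u) v = a * dotv u v.
Proof. by rewrite dotvC dotvZr dotvC. Qed.

Lemma dotvNl p (u v : 'rV[R]_p) : dotv (- u) v = - dotv u v.
Proof. by rewrite dotvC dotvNr dotvC. Qed.

Lemma dotvBl p (u v w : 'rV[R]_p) : dotv (u - v) w = dotv u w - dotv v w.
Proof. by rewrite dotvDl dotvNl. Qed.

Lemma dotvv p (u : 'rV[R]_p) : dotv u u = enorm u ^+ 2.
Proof.
by rewrite sqr_enormE big_ord1; apply: eq_bigr => i _; rewrite expr2.
Qed.

Lemma sqr_enormD p (u v : 'rV[R]_p) :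
  enorm (u + v) ^+ 2 = enorm u ^+ 2 + 2 * dotv u v + enorm v ^+ 2.
Proof. by rewrite -!dotvv dotvDl !dotvDr (dotvC v u); ring. Qed.

Lemma sqr_enormZ p a (u : 'rV[R]_p) : enorm (a *: u) ^+ 2 = a ^+ 2 * enorm u ^+ 2.
Proof. by rewrite -!dotvv dotvZl dotvZr mulrA -expr2. Qed.

Lemma enormZ p a (u : 'rV[R]_p) : enorm (a *: u) = `|a| * enorm u.
Proof.
apply/eqP; rewrite -(@eqrXn2 _ 2) ?mulr_ge0 ?enorm_ge0//.
by rewrite sqr_enormZ exprMn real_normK ?num_real.
Qed.

Lemma enormN p (u : 'rV[R]_p) : enorm (- u) = enorm u.
Proof. by rewrite -scaleN1r enormZ normrN1 mul1r. Qed.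

Lemma enorm0 p : enorm (0 : 'rV[R]_p) = 0.
Proof. by rewrite -(scale0r 0) enormZ normr0 mul0r. Qed.

Lemma enormC p (u v : 'rV[R]_p) : enorm (u - v) = enorm (v - u).
Proof. by rewrite -enormN opprB. Qed.

Lemma coord_le_enorm p (u : 'rV[R]_p) i : `|u 0 i| <= enorm u.
Proof.
rewrite -(@ler_pXn2r _ 2) ?nnegrE ?enorm_ge0// real_normK ?num_real//.
rewrite sqr_enormE big_ord1 (bigD1 i)//= lerDl sumr_ge0// => j _.
exact: sqr_ge0.
Qed.

Lemma enorm_eq0 p (u : 'rV[R]_p) : enorm u = 0 -> u = 0.
Proof.
move=> u0; apply/rowP => i; rewrite mxE; apply/eqP; rewrite -normr_le0.
by rewrite -u0 coord_le_enorm.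
Qed.

(** Cauchy-Schwarz, from the nonnegative square of | |v|^2 u - <u,v> v |. *)
Lemma dotv_le_enorm p (u v : 'rV[R]_p) : `|dotv u v| <= enorm u * enorm v.
Proof.
rewrite -(@ler_pXn2r _ 2) ?nnegrE ?mulr_ge0 ?enorm_ge0// real_normK ?num_real//.
have [v0|v0] := eqVneq (enorm v) 0.
  by rewrite (enorm_eq0 v0) -(scale0r 0) dotvZr !mul0r expr0n sqr_ge0.
have v2 : 0 < enorm v ^+ 2 by rewrite exprn_even_gt0//= v0.
rewrite exprMn -(ler_pM2l v2) -subr_ge0.
have -> : enorm v ^+ 2 * (enorm u ^+ 2 * enorm v ^+ 2) - enorm v ^+ 2 * dotv u v ^+ 2
    = enorm (enorm v ^+ 2 *: u - dotv u v *: v) ^+ 2.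
  by rewrite sqr_enormD dotvNr dotvZl dotvZr enormN !sqr_enormZ; ring.
exact: sqr_ge0.
Qed.

Lemma dotv_le p (u v : 'rV[R]_p) : dotv u v <= enorm u * enorm v.
Proof. exact: le_trans (ler_norm _) (dotv_le_enorm u v). Qed.

Lemma enormD p (u v : 'rV[R]_p) : enorm (u + v) <= enorm u + enorm v.
Proof.
rewrite -(@ler_pXn2r _ 2) ?nnegrE ?addr_ge0 ?enorm_ge0// sqr_enormD.
by have := dotv_le u v; rewrite sqrrD -mulr_natl; lra.
Qed.

(** The defect is exactly t (1 - t) |u - v|^2. In the tracking recursion this handles the cross term
    between old error and drift without weakening the factor 1 - beta. *)
Lemma sqr_enormD_convex p (t : R) (u v : 'rV[R]_p) : 0 <= t <= 1 ->
  enorm ((1 - t) *: u + t *: v) ^+ 2 <=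
  (1 - t) * enorm u ^+ 2 + t * enorm v ^+ 2.
Proof.
move=> /andP[t0 t1]; rewrite -subr_ge0.
have -> : (1 - t) * enorm u ^+ 2 + t * enorm v ^+ 2 -
    enorm ((1 - t) *: u + t *: v) ^+ 2 = t * (1 - t) * enorm (u - v) ^+ 2.
  rewrite !sqr_enormD dotvNr enormN !sqr_enormZ dotvZl dotvZr; ring.
by rewrite mulr_ge0 ?sqr_ge0// mulr_ge0// subr_ge0.
Qed.

Lemma sqr_enormD_le p (u v : 'rV[R]_p) :
  enorm (u + v) ^+ 2 <= 2 * enorm u ^+ 2 + 2 * enorm v ^+ 2.
Proof.
have := sqr_ge0 (enorm (u - v)).
by rewrite !sqr_enormD dotvNr enormN; lra.
Qed.

Lemma enorm_tr p q (A : 'M[R]_(p, q)) : enorm A^T = enorm A.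
Proof.
congr Num.sqrt; rewrite exchange_big/=.
by apply: eq_bigr => i _; apply: eq_bigr => j _; rewrite mxE.
Qed.

(** Cauchy-Schwarz against each column of A; summing the squares produces the Frobenius norm. *)
Lemma enorm_mulmx p q (u : 'rV[R]_p) (A : 'M[R]_(p, q)) :
  enorm (u *m A) <= enorm u * enorm A.
Proof.
rewrite -(@ler_pXn2r _ 2) ?nnegrE ?mulr_ge0 ?enorm_ge0// exprMn -(enorm_tr A).
rewrite [in leLHS]sqr_enormE big_ord1 [X in _ <= _ * X]sqr_enormE mulr_sumr.
apply: ler_sum => j _.
have -> : (u *m A) 0 j = dotv u (row j A^T).
  by rewrite mxE; apply: eq_bigr => i _; rewrite !mxE.
have -> : \sum_k A^T j k ^+ 2 = enorm (row j A^T) ^+ 2.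
  by rewrite sqr_enormE big_ord1; apply: eq_bigr => k _; rewrite !mxE.
rewrite -exprMn -real_normK ?num_real// ler_pXn2r ?nnegrE ?mulr_ge0 ?enorm_ge0//.
exact: dotv_le_enorm.
Qed.

Lemma enorm_le_coord p (u : 'rV[R]_p) (c : R) : 0 <= c ->
  (forall i, `|u 0 i| <= c) -> enorm u <= p%:R * c.
Proof.
move=> c0 uc; rewrite -(@ler_pXn2r _ 2) ?nnegrE ?mulr_ge0 ?enorm_ge0//.
rewrite sqr_enormE big_ord1.
apply: (@le_trans _ _ (\sum_(i < p) c ^+ 2)).
  apply: ler_sum => i _.
  by rewrite -real_normK ?num_real// ler_pXn2r ?nnegrE.
rewrite sumr_const card_ord -[leLHS]mulr_natl exprMn ler_wpM2r ?sqr_ge0//.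
case: p {u uc} => [|p]; first by rewrite expr0n.
by rewrite expr2 ler_peMr// ler1n.
Qed.

Lemma enorm_le_norm p (u : 'rV[R]_p) : enorm u <= p%:R * `|u|.
Proof.
apply: enorm_le_coord => // i.
rewrite [X in _ <= X]/Num.norm/= mx_normE.
exact: (le_bigmax _ (fun ij : 'I_1 * 'I_p => `|u ij.1 ij.2|%:nng) (0, i)).
Qed.

Lemma norm_le_enorm p (u : 'rV[R]_p) : `|u| <= enorm u.
Proof.
have [->|/mx_norm_neq0[[i j]]] := eqVneq `|u| 0; first exact: enorm_ge0.
by rewrite /Num.norm/= => ->/=; rewrite ord1 coord_le_enorm.
Qed.

End euclidean_norm.

(** * Differentiability *)

Section gradients.
Context {R : realType}.

(** Turns quadratic remainder bounds, which survive integration over the samples, into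
    differentiability of the means f and g. *)
Lemma quadratic_remainder_diff (V W : normedModType R) (f : V -> W)
    (df : {linear V -> W}) (x : V) (C : R) : continuous df ->
  (forall z, `|f z - f x - df (z - x)| <= C * `|z - x| ^+ 2) ->
  differentiable f x /\ 'd f x = df :> (V -> W).
Proof.
move=> dfc hf.
have h : f \o shift x = cst (f x) + df +o_ 0 id.
  apply/eqaddoP => /= e e0.
  (* Adding 1 makes the constant positive, so that the radius e / (|C| + 1) is defined without a
     case on C. *)
  have C0 : 0 < `|C| + 1 by rewrite ltr_wpDl.
  near=> v; rewrite /=.
  have -> : (f \o shift x - (cst (f x) + df)) v = f (v + x) - f x - df (v + x - x).
    by rewrite addrK !fctE /= opprD addrA.
  apply: (le_trans (hf _)); rewrite addrK expr2 mulrA ler_wpM2r//.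
  apply: (@le_trans _ _ ((`|C| + 1) * `|v|)).
    by rewrite ler_wpM2r// (le_trans (ler_norm _))// lerDl.
  rewrite -ler_pdivlMl// mulrC.
  near: v; apply: cvgr_norm_le; first exact: cvg_id.
  by rewrite normr0 divr_gt0.
have e := diff_unique dfc h.
split=> //; apply/diff_locallyP; split; first by rewrite e.
by rewrite e.
Unshelve. all: by end_near. Qed.

Lemma diff_grad p (h : 'rV[R]_p -> R) (x v : 'rV[R]_p) : differentiable h x ->
  'd h x v = dotv (grad h x) v.
Proof.
move=> dh; rewrite [in LHS](row_sum_delta v) linear_sum.
by apply: eq_bigr => i _; rewrite linearZ mxE deriveE//= mulrC.
Qed.

Lemma grad_comp n m (f : 'rV[R]_m -> R) (g : 'rV[R]_n -> 'rV[R]_m) x :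
  differentiable g x -> differentiable f (g x) ->
  grad (f \o g) x = chain_grad f g (g x) x.
Proof.
move=> dg df; apply/rowP => i; rewrite mxE deriveE; last exact: differentiable_comp.
rewrite diff_comp//= diff_grad// mxE; apply: eq_bigr => j _.
by rewrite [in RHS]mxE /jacobian !mxE.
Qed.

Lemma segment_MVT p (h : 'rV[R]_p -> R) (y w : 'rV[R]_p) :
  (forall x, differentiable h x) ->
  exists2 t : R, 0 <= t <= 1 &
    h (y + w) - h y = dotv (grad h (t *: w + y)) w.
Proof.
move=> dh; pose phi (t : R) := h (t *: w + y).
have dphi (t : R) : is_derive t 1 phi (dotv (grad h (t *: w + y)) w).
  (* Difference quotients of [phi] at t are those of [h] in the direction w at t w + y, so the
     derivative of [phi] is a directional derivative of [h]. *)
  have E : (fun s : R => s^-1 *: ((phi \o shift t) (s *: 1) - phi t)) =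
      (fun s => s^-1 *: ((h \o shift (t *: w + y)) (s *: w) - h (t *: w + y))).
    apply/funext => s; rewrite /phi /=; congr (_ *: (h _ - _)).
    by rewrite [_ *: 1]mulr1 scalerDl addrA.
  have dd : derivable phi t 1.
    by rewrite /derivable E; exact: diff_derivable.
  apply: DeriveDef => //.
  by rewrite /derive E -diff_grad// -deriveE.
have cphi : {within `[0, 1], continuous phi}.
  by apply: derivable_within_continuous => t _; have [] := dphi t.
have [c cI] := @MVT_segment R phi (fun t => dotv (grad h (t *: w + y)) w) 0 1 ler01
  (fun x _ => dphi x) cphi.
rewrite subr0 mulr1 /phi scale1r scale0r add0r [w + y]addrC => e.
by exists c => //; move: cI; rewrite in_itv.
Qed.

(** The mean value theorem on the segment gives the constant L instead of the sharp L/2; only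
    differentiability and integrability are drawn from it. *)
Lemma lipschitz_grad_remainder p (h : 'rV[R]_p -> R) (L : R) (y z : 'rV[R]_p) :
  (forall x, differentiable h x) -> 0 <= L ->
  (forall u v, enorm (grad h u - grad h v) <= L * enorm (u - v)) ->
  `|h z - h y - dotv (grad h y) (z - y)| <= L * enorm (z - y) ^+ 2.
Proof.
move=> dh L0 hL; have [t /andP[t0 t1]] := segment_MVT y (z - y) dh.
rewrite [y + _]addrC subrK => ->; rewrite -dotvBl (le_trans (dotv_le_enorm _ _))//.
rewrite expr2 mulrA ler_wpM2r ?enorm_ge0// (le_trans (hL _ _))//.
rewrite addrK enormZ ger0_norm// ler_wpM2l// ler_piMl ?enorm_ge0//.
Qed.

Lemma cvg_harmonic_dnbhs : (n.+1%:R^-1 : R) @[n --> \oo] --> 0^'.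
Proof.
move=> A A0; have : nbhs (0 : R) (fun y => y != 0 -> A y) by exact: A0.
move=> /(@cvg_harmonic R); rewrite /nbhs/=; apply: filterS => n; apply.
by rewrite /= invr_eq0 pnatr_eq0.
Qed.

(** As limits of a sequence of difference quotients, derivatives inherit measurability, both in the
    random index and in the point. *)
Lemma derive_cvg_seq (V W : normedModType R) (f : V -> W) (x v : V) :
  derivable f x v ->
  (n.+1%:R : R) *: (f (n.+1%:R^-1 *: v + x) - f x) @[n --> \oo] --> 'D_v f x.
Proof.
move=> df; apply: cvg_trans (cvg_trans (cvg_app _ cvg_harmonic_dnbhs) df).
by apply: near_eq_cvg; near=> n => /=; rewrite invrK.
Unshelve. all: by end_near. Qed.

Lemma grad_cvg p (h : 'rV[R]_p -> R) (x : 'rV[R]_p) i : differentiable h x ->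
  (n.+1%:R : R) * (h (n.+1%:R^-1 *: delta_mx 0 i + x) - h x) @[n --> \oo]
    --> grad h x 0 i.
Proof. by move=> dh; rewrite mxE; apply/derive_cvg_seq/diff_derivable. Qed.

Lemma jacobian_cvg n m (g : 'rV[R]_n -> 'rV[R]_m) (x : 'rV[R]_n) i j :
  differentiable g x ->
  (k.+1%:R : R) * (g (k.+1%:R^-1 *: delta_mx 0 i + x) 0 j - g x 0 j) @[k --> \oo]
    --> 'J g x i j.
Proof.
move=> dg; have -> : 'J g x i j = ('D_(delta_mx 0 i) g x) 0 j.
  by rewrite deriveE// /jacobian mxE.
have h := derive_cvg_seq (diff_derivable (v := delta_mx 0 i) dg).
have := cvg_comp _ _ h (@coord_continuous R 1 m 0 j ('D_(delta_mx 0 i) g x)).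
apply: cvg_trans; apply: near_eq_cvg; near=> k => /=.
by rewrite !mxE.
Unshelve. all: by end_near. Qed.

Lemma mulmxr_continuous n m (A : 'M[R]_(n, m)) :
  continuous (mulmxr A : 'rV[R]_n -> 'rV[R]_m).
Proof.
apply: bounded_linear_continuous; apply/linear_boundedP.
near=> r => x /=; rewrite (le_trans (norm_le_enorm _))//.
rewrite (le_trans (enorm_mulmx _ _))// mulrC.
have h : enorm A * (n%:R * `|x|) <= r * `|x|.
  by rewrite mulrA ler_wpM2r//; near: r; apply: nbhs_pinfty_ge; rewrite num_real.
by apply: le_trans h; rewrite ler_wpM2l ?enorm_ge0// enorm_le_norm.
Unshelve. all: by end_near. Qed.

Fact dotv_is_linear p (s : 'rV[R]_p) : linear_for *:%R (dotv s : 'rV[R]_p -> R^o).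
Proof. by move=> a u v; rewrite dotvDr dotvZr. Qed.

HB.instance Definition _ p (s : 'rV[R]_p) :=
  GRing.isLinear.Build R 'rV[R]_p R^o *:%R (dotv s) (dotv_is_linear s).

Lemma dotv_continuous p (s : 'rV[R]_p) : continuous (dotv s : 'rV[R]_p -> R^o).
Proof.
apply: bounded_linear_continuous; apply/linear_boundedP.
near=> r => x /=; rewrite (le_trans (dotv_le_enorm _ _))//.
have h : enorm s * (p%:R * `|x|) <= r * `|x|.
  by rewrite mulrA ler_wpM2r//; near: r; apply: nbhs_pinfty_ge; rewrite num_real.
by apply: le_trans h; rewrite ler_wpM2l ?enorm_ge0// enorm_le_norm.
Unshelve. all: by end_near. Qed.

Lemma quadratic_remainder_diff_real p (h : 'rV[R]_p -> R) (y s : 'rV[R]_p) (C : R) :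
  (forall z, `|h z - h y - dotv s (z - y)| <= C * enorm (z - y) ^+ 2) ->
  differentiable h y /\ grad h y = s.
Proof.
move=> hs.
have [] := @quadratic_remainder_diff 'rV[R]_p R^o h (dotv s) y (`|C| * p%:R ^+ 2)
  (@dotv_continuous p s).
  move=> z; apply: (le_trans (hs z)); apply: (@le_trans _ _ (`|C| * enorm (z - y) ^+ 2)).
    by rewrite ler_wpM2r ?sqr_ge0// ler_norm.
  rewrite -mulrA ler_wpM2l// -exprMn ler_pXn2r ?nnegrE ?mulr_ge0 ?enorm_ge0//.
  exact: enorm_le_norm.
move=> dh e; split=> //; apply/rowP => i; rewrite mxE deriveE// e/=.
rewrite /dotv (bigD1 i)//= mxE !eqxx mulr1 big1 ?addr0// => j ji.
by rewrite mxE eqxx/= (negbTE ji) mulr0.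
Qed.

Lemma quadratic_remainder_diff_vec n m (g : 'rV[R]_n -> 'rV[R]_m) (x : 'rV[R]_n)
    (A : 'M[R]_(n, m)) (C : R) :
  (forall z, enorm (g z - g x - (z - x) *m A) <= C * enorm (z - x) ^+ 2) ->
  differentiable g x.
Proof.
move=> hA.
have [] // := @quadratic_remainder_diff _ _ g (mulmxr A) x (`|C| * n%:R ^+ 2)
  (@mulmxr_continuous n m A).
move=> z; apply: (le_trans (norm_le_enorm _)); apply: (le_trans (hA z)).
apply: (@le_trans _ _ (`|C| * enorm (z - x) ^+ 2)).
  by rewrite ler_wpM2r ?sqr_ge0// ler_norm.
rewrite -mulrA ler_wpM2l// -exprMn ler_pXn2r ?nnegrE ?mulr_ge0 ?enorm_ge0//.
exact: enorm_le_norm.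
Qed.

End gradients.

(** * Measurability *)

Section caratheodory.
Context {R : realType} (d : measure_display) (T : measurableType d) (p : nat).

Let grid (n : nat) (c : 'rV[int]_p) : 'rV[R]_p :=
  \row_i ((c 0 i)%:~R / n.+1%:R).

Let cell (n : nat) (y : 'rV[R]_p) : 'rV[int]_p :=
  \row_i Num.floor (n.+1%:R * y 0 i).

Let grid_cell n y : enorm (grid n (cell n y) - y) <= p%:R * n.+1%:R^-1.
Proof.
apply: enorm_le_coord => [|i]; first by rewrite invr_ge0.
rewrite !mxE -normrN opprB.
have /andP[h1 h2] := floor_itv (n.+1%:R * y 0 i).
have n0 : 0 < n.+1%:R :> R by rewrite ltr0n.
rewrite -(ler_pM2l n0) mulfV ?gt_eqF// -[X in X * _](gtr0_norm n0) -normrM.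
rewrite mulrBr [X in _ - X]mulrCA mulfV ?gt_eqF// mulr1.
rewrite ger0_norm ?subr_ge0//.
by rewrite lerBlDl ltW// (lt_le_trans h2)// intrD.
Qed.

(** Y t is rounded down to the grid of mesh 1/(n+1). The rounded point takes countably many values,
    and on each of them h is measurable in t; continuity of h t gives the limit. Indexing cells by
    integer vectors makes countability immediate. *)
Lemma measurable_caratheodory (h : T -> 'rV[R]_p -> R) (Y : T -> 'rV[R]_p) :
  (forall y, measurable_fun setT (fun t => h t y)) ->
  (forall t, continuous (h t)) ->
  (forall i, measurable_fun setT (fun t => Y t 0 i)) ->
  measurable_fun setT (fun t => h t (Y t)).
Proof.
move=> mh ch mY.
apply: (@measurable_fun_cvg _ _ _ _ (fun n t => h t (grid n (cell n (Y t))))).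
  move=> n _ A mA; rewrite setTI.
  have -> : (fun t => h t (grid n (cell n (Y t)))) @^-1` A =
      \bigcup_(c in [set: 'rV[int]_p])
        ([set t | cell n (Y t) = c] `&` [set t | A (h t (grid n c))]).
    apply/seteqP; split=> [t At|t [c _ [/= <- //]]].
    by exists (cell n (Y t)).
  apply: countable_bigcupT_measurable => [|c]; first exact: countableP.
  apply: measurableI; last by rewrite -[X in measurable X]setTI; exact: mh.
  have -> : [set t | cell n (Y t) = c] = \bigcap_(i in [set: 'I_p])
      ((fun t => n.+1%:R * Y t 0 i) @^-1` `[(c 0 i)%:~R, (c 0 i + 1)%:~R[%classic).
    apply/seteqP; split=> [t /= <- i _|t /= tc].
      by rewrite /= in_itv/= mxE floor_itv.
    apply/rowP => i; rewrite mxE; apply/eqP; rewrite floor_eq.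
    by have := tc i I; rewrite /= in_itv.
  apply: fin_bigcap_measurable => // i _.
  rewrite -[X in measurable X]setTI.
  have mM : measurable_fun setT (fun t => n.+1%:R * Y t 0 i).
    exact: measurable_funM (measurable_cst _) (mY i).
  by apply: mM => //; exact: measurable_itv.
move=> t _.
apply: (@cvg_comp _ _ _ (fun n => grid n (cell n (Y t))) (h t) _ (nbhs (Y t))).
  apply/cvgrPdist_le => e e0.
  have p0 : 0 < p%:R + 1 :> R by rewrite ltr_wpDl.
  near=> n; rewrite distrC (le_trans (norm_le_enorm _))//.
  rewrite (le_trans (grid_cell n (Y t)))//.
  apply: (@le_trans _ _ ((p%:R + 1) * n.+1%:R^-1)).
    by rewrite ler_wpM2r ?invr_ge0// lerDl.
  rewrite -ler_pdivlMl// mulrC ltW//.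
  near: n; have := @cvg_harmonic R => /cvgrPdist_lt/(_ _ (divr_gt0 e0 p0)).
  by apply: filterS => n /=; rewrite sub0r normrN ger0_norm ?invr_ge0.
exact: ch.
Unshelve. all: by end_near. Qed.
End caratheodory.

Lemma measurable_cont_comp {R : realType} (d : measure_display)
    (T : measurableType d) p (h : 'rV[R]_p -> R) (Y : T -> 'rV[R]_p) :
  continuous h -> (forall i, measurable_fun setT (fun t => Y t 0 i)) ->
  measurable_fun setT (fun t => h (Y t)).
Proof. by move=> ch mY; apply: (@measurable_caratheodory _ _ _ _ (fun=> h)). Qed.

(** F is shown to be differentiable but its gradient is not shown to be continuous, so measurability
    comes from difference quotients. *)
Lemma measurable_grad_comp {R : realType} (d : measure_display)
    (T : measurableType d) p (h : 'rV[R]_p -> R) (Y : T -> 'rV[R]_p) i :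
  (forall x, differentiable h x) ->
  (forall i, measurable_fun setT (fun t => Y t 0 i)) ->
  measurable_fun setT (fun t => grad h (Y t) 0 i).
Proof.
move=> dh mY.
have ch : continuous h by move=> x; exact: differentiable_continuous.
apply: (@measurable_fun_cvg _ _ _ _ (fun k t =>
  k.+1%:R * (h (k.+1%:R^-1 *: delta_mx 0 i + Y t) - h (Y t)))).
  move=> k; apply: (measurable_funM (measurable_cst _)); apply: measurable_funB.
    apply: measurable_cont_comp => // j; under eq_fun do rewrite mxE.
    exact: measurable_funD (measurable_cst _) (mY j).
  exact: measurable_cont_comp.
by move=> t _; exact: grad_cvg.
Qed.

Lemma measurable_dotv {R : realType} (d : measure_display)
    (T : measurableType d) p (u v : T -> 'rV[R]_p) :
  (forall i, measurable_fun setT (fun t => u t 0 i)) ->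
  (forall i, measurable_fun setT (fun t => v t 0 i)) ->
  measurable_fun setT (fun t => dotv (u t) (v t)).
Proof. by move=> mu mv; apply: measurable_sum => i; exact: measurable_funM. Qed.

Lemma measurable_coordD {R : realType} (d : measure_display)
    (T : measurableType d) p (u v : T -> 'rV[R]_p) :
  (forall i, measurable_fun setT (fun t => u t 0 i)) ->
  (forall i, measurable_fun setT (fun t => v t 0 i)) ->
  forall i, measurable_fun setT (fun t => (u t + v t) 0 i).
Proof.
by move=> mu mv i; under eq_fun do rewrite mxE; exact: measurable_funD.
Qed.

Lemma measurable_coordZ {R : realType} (d : measure_display)
    (T : measurableType d) p (a : R) (u : T -> 'rV[R]_p) :
  (forall i, measurable_fun setT (fun t => u t 0 i)) ->
  forall i, measurable_fun setT (fun t => (a *: u t) 0 i).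
Proof.
by move=> mu i; under eq_fun do rewrite mxE; exact: measurable_funM (measurable_cst _) (mu i).
Qed.

Lemma measurable_coordB {R : realType} (d : measure_display)
    (T : measurableType d) p (u v : T -> 'rV[R]_p) :
  (forall i, measurable_fun setT (fun t => u t 0 i)) ->
  (forall i, measurable_fun setT (fun t => v t 0 i)) ->
  forall i, measurable_fun setT (fun t => (u t - v t) 0 i).
Proof.
move=> mu mv i; under eq_fun do rewrite !mxE.
exact: measurable_funB.
Qed.

Lemma measurable_sqr_enorm {R : realType} (d : measure_display) (T : measurableType d) p
    (v : T -> 'rV[R]_p) : (forall i, measurable_fun setT (fun t => v t 0 i)) ->
  measurable_fun setT (fun t => enorm (v t) ^+ 2).
Proof.
move=> mv; under eq_fun do rewrite sqr_enormE big_ord1.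
by apply: measurable_sum => i; exact: measurable_funX.
Qed.

(** * Independence and freezing *)

Section freezing.
Local Open Scope ereal_scope.
Context {R : realType} (d dS dU : measure_display) (T : measurableType d)
  (S : measurableType dS) (U : measurableType dU) (P : probability T R)
  (mu : probability S R) (X : {RV P >-> S}) (Y : {RV P >-> U}).
Hypothesis indep : forall (A : set U) (B : set S), measurable A -> measurable B ->
  P (Y @^-1` A `&` X @^-1` B) = P (Y @^-1` A) * mu B.

Let YX_fun (t : T) : U * S := (Y t, X t).

Let YX_measurable : measurable_fun setT YX_fun.
Proof. exact: measurable_fun_pair. Qed.

HB.instance Definition _ := isMeasurableFun.Build _ _ _ _ YX_fun YX_measurable.

Let YX : {RV P >-> (U * S)%type} := YX_fun.

Let law_pair (C : set (U * S)) : measurable C ->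
  (distribution P Y \x mu) C = distribution P YX C.
Proof.
by move=> mC; apply: product_measure_unique => // A B mA mB; exact: indep.
Qed.

(** Independence makes the law of (Y, X) a product measure, and Tonelli integrates X out first. This
    plays the role of conditioning on Y. *)
Lemma ge0_integral_freeze (h : U * S -> \bar R) :
  measurable_fun setT h -> (forall u, 0 <= h u) ->
  \int[P]_t h (Y t, X t) = \int[P]_t \int[mu]_s h (Y t, s).
Proof.
move=> mh h0.
have := ge0_integral_distribution YX mh h0; rewrite /= => <-.
rewrite (eq_measure_integral (distribution P Y \x mu)); last first.
  by move=> A mA _; exact/esym/law_pair.
rewrite fubini_tonelli1//.
rewrite (ge0_integral_distribution Y)//.
- exact: measurable_fun_fubini_tonelli_F.
- by move=> y; apply: integral_ge0.
Qed.

Lemma integral_freeze (h : U * S -> \bar R) : measurable_fun setT h ->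
  P.-integrable setT (fun t => h (Y t, X t)) ->
  P.-integrable setT (fun t => \int[mu]_s h (Y t, s)) /\
  \int[P]_t h (Y t, X t) = \int[P]_t \int[mu]_s h (Y t, s).
Proof.
move=> mh ih.
have ih' : (distribution P Y \x mu).-integrable setT h.
  apply/integrableP; split => //.
  rewrite (eq_measure_integral (distribution P YX)); last first.
    by move=> A mA _; exact: law_pair.
  rewrite (ge0_integral_distribution YX)//; last exact: measurableT_comp.
  by have /integrableP[] := ih.
have iF := integrable_fubini_F ih'.
have iFY : P.-integrable setT (fun t => \int[mu]_s h (Y t, s)).
  apply/integrableP; split.
    by apply: (measurableT_comp (measurable_int _ iF)).
  have /integrableP[mF] := iF.
  by rewrite (ge0_integral_distribution Y)//; exact: measurableT_comp.
split => //.
have := @integral_distribution _ _ _ _ _ P YX h mh ih; rewrite /= => <-.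
rewrite (eq_measure_integral (distribution P Y \x mu)); last first.
  by move=> A mA _; exact/esym/law_pair.
rewrite -integral12_prod_meas1// (@integral_distribution _ _ _ _ _ P Y)//.
exact: measurable_int iF.
Qed.

End freezing.

(** * The filtration generated by the samples *)

Section past.
Context {R : realType} (d dS : measure_display) (T : measurableType d)
  (S : measurableType dS) (P : probability T R)
  (mu : probability S R) (xi : nat -> {RV P >-> S}).

(** Cylinders over the indices 1 to k form a pi-system. For k = 0 the only cylinder is the whole
    space, so the constant [x1] is measurable for the empty past. *)
Definition past_cylinders (k : nat) : set (set T) :=
  [set B | exists2 A : nat -> set S, (forall j, measurable (A j)) &
     B = \bigcap_(j in [set` iota 1 k]) (xi j @^-1` A j)].

Definition past (k : nat) := g_sigma_algebraType (past_cylinders k).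

Lemma past_cylinders_measurable k : past_cylinders k `<=` measurable.
Proof.
move=> _ [A mA ->]; apply: bigcap_measurableType => j _.
by rewrite -[X in measurable X]setTI; exact: measurable_funP.
Qed.

Lemma past_cylindersI k : setI_closed (past_cylinders k).
Proof.
move=> _ _ [A mA ->] [B mB ->]; exists (fun j => A j `&` B j).
  by move=> j; exact: measurableI.
by rewrite -bigcapI; apply: eq_bigcapr => j _; rewrite preimage_setI.
Qed.

Lemma past_cylindersT k : past_cylinders k setT.
Proof.
exists (fun=> setT) => //; apply/seteqP; split=> //.
Qed.

Lemma past_sub_measurable k (B : set T) :
  measurable (B : set (past k)) -> measurable B.
Proof.
move: B; apply: smallest_sub; first exact: sigma_algebra_measurable.
exact: past_cylinders_measurable.
Qed.

Lemma measurable_fun_past k dU (U : measurableType dU) (f : T -> U) :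
  measurable_fun setT (f : past k -> U) -> measurable_fun setT f.
Proof. by move=> mf _ A mA; apply: (@past_sub_measurable k); exact: mf. Qed.

Lemma past_sample_measurable j k : (0 < j <= k)%N ->
  measurable_fun setT (xi j : past k -> S).
Proof.
move=> /andP[j0 jk] _ A mA; apply: sub_sigma_algebra; rewrite setTI.
exists (fun i => if i == j then A else setT).
  by move=> i; case: ifP.
apply/seteqP; split=> [t At i /= _|t /(_ j)/=].
  by case: eqP => [->|].
by rewrite eqxx mem_iota j0 add1n ltnS jk; exact.
Qed.

Lemma past_subS k (B : set T) :
  measurable (B : set (past k)) -> measurable (B : set (past k.+1)).
Proof.
move: B; apply: smallest_sub; first exact: (@sigma_algebra_measurable _ (past k.+1)).
move=> _ [A mA ->]; apply: bigcap_measurableType => j /= jk.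
rewrite -[X in measurable X]setTI; apply: past_sample_measurable => //.
by move: jk; rewrite mem_iota add1n => /andP[-> /ltnW].
Qed.

Lemma measurable_fun_pastS k dU (U : measurableType dU) (f : T -> U) :
  measurable_fun setT (f : past k -> U) ->
  measurable_fun setT (f : past k.+1 -> U).
Proof. by move=> mf _ A mA; apply: past_subS; exact: mf. Qed.

(** The identity, seen as a random variable with values in the coarser space. Freezing it freezes
    every function of the first k samples at once, with no tuple of samples to build. *)
Definition past_id k : T -> past k := id.

Lemma past_id_measurable k : measurable_fun setT (@past_id k).
Proof. by move=> _ B mB; rewrite setTI; exact: (@past_sub_measurable k). Qed.

HB.instance Definition _ k :=
  isMeasurableFun.Build _ _ T (past k) (@past_id k) (@past_id_measurable k).

Hypothesis xi_indep : mutually_independent [set k | (0 < k)%N] xi.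
Hypothesis xi_law : forall k, (0 < k)%N -> forall A, measurable A ->
  distribution P (xi k) A = mu A.

Lemma cylinder_indep k (B : set T) (D : set S) : past_cylinders k B ->
  measurable D ->
  P (B `&` xi k.+1 @^-1` D) = (P B * mu D)%E.
Proof.
move=> [A mA ->] mD.
(* Intersecting with the event on sample k+1 gives a cylinder over one more index, to which mutual
   independence applies directly. *)
pose A' j := if j == k.+1 then D else A j.
have mA' j : measurable (A' j) by rewrite /A'; case: ifP.
have sub m : [set` iota 1 m] `<=` [set k | (0 < k)%N].
  by move=> j /=; rewrite mem_iota => /andP[].
have -> : \bigcap_(j in [set` iota 1 k]) xi j @^-1` A j =
    \bigcap_(j in [set` iota 1 k]) xi j @^-1` A' j.
  apply: eq_bigcapr => j /=; rewrite mem_iota add1n ltnS => /andP[_ jk].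
  by rewrite /A' ltn_eqF// ltnS.
have -> : \bigcap_(j in [set` iota 1 k]) xi j @^-1` A' j `&` xi k.+1 @^-1` D =
    \bigcap_(j in [set` iota 1 k.+1]) xi j @^-1` A' j.
  apply/seteqP; split=> [t [hA hD] j jI|t hA].
    have : j \in iota 1 k.+1 by exact: jI.
    rewrite mem_iota add1n => /andP[j0]; rewrite ltnS leq_eqVlt.
    case: eqP => [-> _|_ /= jk]; first by rewrite /A' eqxx.
    by apply: hA; rewrite /= mem_iota j0 add1n.
  split=> [j /=|].
    rewrite mem_iota add1n => /andP[j0 jk]; apply: hA.
    suff : j \in iota 1 k.+1 by [].
    by rewrite mem_iota j0 add1n ltnW.
  have : k.+1 \in iota 1 k.+1 by rewrite mem_iota add1n ltnS/=.
  by move=> /hA; rewrite /A' eqxx.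
rewrite !(xi_indep (iota_uniq _ _) (@sub _) mA').
rewrite (_ : iota 1 k.+1 = iota 1 k ++ [:: k.+1]); last first.
  by rewrite -[in LHS](addn1 k) iotaD add1n.
rewrite big_cat/= big_seq1; congr (_ * _)%E.
by rewrite -(xi_law (ltn0Sn k) mD) /distribution /pushforward /A' eqxx.
Qed.

(** For fixed D both sides are finite measures in B, a restriction and a multiple of P. They agree
    on the pi-system of cylinders, hence on the sigma-algebra it generates. *)
Lemma past_indep k (B : set (past k)) (D : set S) : measurable B ->
  measurable D ->
  P (@past_id k @^-1` B `&` xi k.+1 @^-1` D) = (P (@past_id k @^-1` B) * mu D)%E.
Proof.
move=> mB mD.
have mXD : measurable (xi k.+1 @^-1` D).
  by rewrite -[X in measurable X]setTI; exact: measurable_funP.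
have r0 : 0 <= fine (mu D) by rewrite fine_ge0.
have E (C : set T) : mscale (NngNum r0) P C = (P C * mu D)%E.
  by rewrite /mscale/= fineK ?fin_num_measure// muleC.
rewrite -[RHS]E -[LHS]/(mrestr P mXD B).
pose m1 : {measure set T -> \bar R} := mrestr P mXD.
pose m2 : {measure set T -> \bar R} := mscale (NngNum r0) P.
apply: (@g_sigma_algebra_measure_unique d R T (past_cylinders k)
  (@past_cylinders_measurable k) (fun=> setT) _ _ m1 m2) => //.
- by move=> _; exact: past_cylindersT.
- by rewrite bigcup_const.
- exact: past_cylindersI.
- by move=> C cC; rewrite /m2/= E; exact: cylinder_indep.
- by move=> _; rewrite /m1/= /mrestr setTI (le_lt_trans (probability_le1 _ _))// ltry.
Qed.

End past.

(** * Integrals under a probability *)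

Section probability_integrals.
Context {R : realType} (d : measure_display) (T : measurableType d)
  (P : probability T R).
Implicit Types f g : T -> R.

Lemma ae_bounded_integrable f (c : R) : measurable_fun setT f -> 0 <= c ->
  {ae P, forall t, `|f t| <= c} -> P.-integrable setT (EFin \o f).
Proof.
move=> mf c0 fc; apply/integrableP; split; first exact/measurable_EFinP.
apply: (@le_lt_trans _ _ (\int[P]_t c%:E)%E).
  apply: ae_ge0_le_integral => //.
  - apply: measurableT_comp => //; exact/measurable_EFinP.
  - by apply: filterS fc => t fc _; rewrite /= lee_fin.
by rewrite integral_cst//= probability_setT mule1 ltry.
Qed.

Lemma ae_le_Rintegral f g : P.-integrable setT (EFin \o f) ->
  P.-integrable setT (EFin \o g) -> {ae P, forall t, f t <= g t} ->
  \int[P]_t f t <= \int[P]_t g t.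
Proof.
move=> fi gi [N [mN N0 fgN]].
rewrite /Rintegral (negligible_integral mN measurableT fi N0).
rewrite (negligible_integral mN measurableT gi N0).
have mD : measurable ([set: T] `\` N) by exact: measurableD.
apply: le_Rintegral => //.
- exact: integrableS fi.
- exact: integrableS gi.
- by move=> t [_ Nt]; apply: contrapT => h; apply: Nt; exact: fgN.
Qed.

Lemma ae_dominated_integrable f g : measurable_fun setT f ->
  P.-integrable setT (EFin \o g) -> {ae P, forall t, `|f t| <= g t} ->
  P.-integrable setT (EFin \o f).
Proof.
move=> mf /integrableP[mg gi] fg; apply/integrableP; split.
  exact/measurable_EFinP.
apply: le_lt_trans gi; apply: ae_ge0_le_integral => //.
- by apply: measurableT_comp => //; exact/measurable_EFinP.
- exact: measurableT_comp.
- by apply: filterS fg => t fg _; rewrite /= lee_fin (le_trans fg)// ler_norm.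
Qed.

Lemma Rintegral_prob_cst (c : R) : \int[P]_t c = c.
Proof. by rewrite Rintegral_cst//= probability_setT mulr1. Qed.

Lemma integrable_prob_cst (c : R) : P.-integrable setT (EFin \o (fun _ : T => c)).
Proof. exact: finite_measure_integrable_cst. Qed.

Lemma ae_Rintegral_le f (c : R) : P.-integrable setT (EFin \o f) ->
  {ae P, forall t, f t <= c} -> \int[P]_t f t <= c.
Proof.
move=> fi fc; rewrite -[leRHS]Rintegral_prob_cst.
by apply: ae_le_Rintegral => //; exact: integrable_prob_cst.
Qed.

Lemma ae_norm_Rintegral_le f (c : R) : P.-integrable setT (EFin \o f) ->
  {ae P, forall t, `|f t| <= c} -> `|\int[P]_t f t| <= c.
Proof.
move=> fi fc; apply: (le_trans (le_normr_Rintegral measurableT fi)).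
by apply: ae_Rintegral_le => //; exact: integrable_norm.
Qed.

Lemma integrable_Rsum (I : Type) (s : seq I) (h : I -> T -> R) :
  (forall i, P.-integrable setT (EFin \o h i)) ->
  P.-integrable setT (EFin \o (fun t => \sum_(i <- s) h i t)).
Proof.
move=> hi; apply: (eq_integrable measurableT (fun t => \sum_(i <- s) (h i t)%:E)%E).
  by move=> t _; rewrite /= sumEFin.
by apply: integrable_sum => // i _; exact: hi.
Qed.

Lemma Rintegral_sum (I : Type) (s : seq I) (h : I -> T -> R) :
  (forall i, P.-integrable setT (EFin \o h i)) ->
  \int[P]_t (\sum_(i <- s) h i t) = \sum_(i <- s) \int[P]_t h i t.
Proof.
move=> hi; elim: s => [|i s IH].
  by rewrite big_nil; under eq_Rintegral do rewrite big_nil; rewrite Rintegral_prob_cst.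
rewrite big_cons -IH; under eq_Rintegral do rewrite big_cons.
by rewrite RintegralD//; exact: integrable_Rsum.
Qed.

Lemma integrable_Rscale (c : R) f : P.-integrable setT (EFin \o f) ->
  P.-integrable setT (EFin \o (fun t => c * f t)).
Proof. by move=> fi; apply: (integrableZl measurableT c fi). Qed.

Lemma integrable_RD f g : P.-integrable setT (EFin \o f) ->
  P.-integrable setT (EFin \o g) -> P.-integrable setT (EFin \o (fun t => f t + g t)).
Proof. by move=> fi gi; apply: (integrableD measurableT fi gi). Qed.

Lemma integrable_RB f g : P.-integrable setT (EFin \o f) ->
  P.-integrable setT (EFin \o g) -> P.-integrable setT (EFin \o (fun t => f t - g t)).
Proof. by move=> fi gi; apply: (integrableB measurableT fi gi). Qed.

Lemma EFin_Rintegral f : P.-integrable setT (EFin \o f) ->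
  ((\int[P]_t f t)%:E = \int[P]_t (f t)%:E)%E.
Proof. by move=> fi; rewrite fineK//; exact: integrable_fin_num. Qed.

End probability_integrals.

(** * Transfer from the law [mu] to a sample *)

Section sample_law.
Context {R : realType} (d dS : measure_display) (T : measurableType d)
  (S : measurableType dS) (P : probability T R) (mu : probability S R)
  (X : {RV P >-> S}).
Hypothesis X_law : forall A, measurable A -> distribution P X A = mu A.

Lemma ae_law (Q : S -> Prop) : {ae mu, forall s, Q s} -> {ae P, forall t, Q (X t)}.
Proof.
move=> [N [mN N0 QN]]; exists (X @^-1` N); split.
- by rewrite -[X in measurable X]setTI; exact: measurable_funP.
- by have := X_law mN; rewrite N0.
- by move=> t /= Qt; exact: QN.
Qed.

Lemma integral_law (h : S -> \bar R) : measurable_fun setT h ->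
  (\int[P]_t h (X t) = \int[mu]_s h s)%E.
Proof.
move=> mh; rewrite [RHS](eq_measure_integral (distribution P X)); last first.
  by move=> A mA _; exact/esym/X_law.
rewrite [RHS]integralE [LHS]integralE.
have hp := ge0_integral_distribution X (measurable_funepos mh) (funepos_ge0 h).
have hn := ge0_integral_distribution X (measurable_funeneg mh) (funeneg_ge0 h).
by rewrite hp hn -funepos_comp -funeneg_comp.
Qed.

End sample_law.

(** * The composition problem *)

Section composition.
Context {R : realType} (n m : nat) (dW dV : measure_display)
  (W : measurableType dW) (V : measurableType dV)
  (mu : probability (W * V)%type R) (fv : V -> 'rV[R]_m -> R)
  (gw : W -> 'rV[R]_n -> 'rV[R]_m).
Hypothesis fv_C1 : forall v, C1_real (fv v).
Hypothesis gw_C1 : forall w, C1_vec (gw w).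
Hypothesis fv_int : forall y, mu.-integrable setT (fun p => (fv p.2 y)%:E).
Hypothesis gw_int : forall x i, mu.-integrable setT (fun p => (gw p.1 x 0 i)%:E).

Let f := mean_f mu fv.
Let g := mean_g mu gw.
Let G (p : W * V) (x : 'rV[R]_n) (y : 'rV[R]_m) := chain_grad (fv p.2) (gw p.1) y x.

Lemma fv_measurable y : measurable_fun setT (fun p : W * V => fv p.2 y).
Proof. by apply/measurable_EFinP; have /integrableP[] := fv_int y. Qed.

Lemma gw_measurable x i : measurable_fun setT (fun p : W * V => gw p.1 x 0 i).
Proof. by apply/measurable_EFinP; have /integrableP[] := gw_int x i. Qed.

Lemma grad_fv_measurable y i :
  measurable_fun setT (fun p : W * V => grad (fv p.2) y 0 i).
Proof.
apply: (@measurable_fun_cvg _ _ _ _ (fun k (p : W * V) =>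
  k.+1%:R * (fv p.2 (k.+1%:R^-1 *: delta_mx 0 i + y) - fv p.2 y))).
  move=> k; apply: (measurable_funM (measurable_cst _)).
  exact: measurable_funB (fv_measurable _) (fv_measurable _).
by move=> p _; apply: grad_cvg; have [] := fv_C1 p.2.
Qed.

Lemma jacobian_gw_measurable x i j :
  measurable_fun setT (fun p : W * V => 'J (gw p.1) x i j).
Proof.
apply: (@measurable_fun_cvg _ _ _ _ (fun k (p : W * V) =>
  k.+1%:R * (gw p.1 (k.+1%:R^-1 *: delta_mx 0 i + x) 0 j - gw p.1 x 0 j))).
  move=> k; apply: (measurable_funM (measurable_cst _)).
  exact: measurable_funB (gw_measurable _ _) (gw_measurable _ _).
by move=> p _; apply: jacobian_cvg; have [] := gw_C1 p.1.
Qed.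

Lemma chain_gradE p x y i :
  G p x y 0 i = \sum_j grad (fv p.2) y 0 j * 'J (gw p.1) x i j.
Proof. by rewrite mxE; apply: eq_bigr => j _; rewrite [X in _ * X]mxE. Qed.

Section random_arguments.
Context (d : measure_display) (T : measurableType d).
Variables (X : T -> W * V) (x : T -> 'rV[R]_n) (y : T -> 'rV[R]_m).
Hypothesis mX : measurable_fun setT X.
Hypothesis mx : forall i, measurable_fun setT (fun t => x t 0 i).
Hypothesis my : forall i, measurable_fun setT (fun t => y t 0 i).

Lemma measurable_gw_comp i : measurable_fun setT (fun t => gw (X t).1 (x t) 0 i).
Proof.
apply: (@measurable_caratheodory _ _ _ _ (fun t x => gw (X t).1 x 0 i)) => //.
  by move=> u; apply: (measurableT_comp (gw_measurable u i) mX).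
move=> t u; apply: (@continuous_comp _ _ _ (gw (X t).1) (fun M => M 0 i)).
  by apply: differentiable_continuous; have [] := gw_C1 (X t).1.
exact: coord_continuous.
Qed.

Lemma measurable_chain_grad_comp i :
  measurable_fun setT (fun t => G (X t) (x t) (y t) 0 i).
Proof.
rewrite (_ : (fun t => _) = fun t =>
  \sum_j grad (fv (X t).2) (y t) 0 j * 'J (gw (X t).1) (x t) i j); last first.
  by apply/funext => t; exact: chain_gradE.
apply: measurable_sum => j; apply: measurable_funM.
  apply: (@measurable_caratheodory _ _ _ _ (fun t y => grad (fv (X t).2) y 0 j)) => //.
    by move=> u; apply: (measurableT_comp (grad_fv_measurable u j) mX).
  move=> t u; apply: (@continuous_comp _ _ _ (grad (fv (X t).2)) (fun M => M 0 j)).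
    by have [_] := fv_C1 (X t).2; exact.
  exact: coord_continuous.
apply: (@measurable_caratheodory _ _ _ _ (fun t x => 'J (gw (X t).1) x i j)) => //.
  by move=> u; apply: (measurableT_comp (jacobian_gw_measurable u i j) mX).
move=> t u; apply: (@continuous_comp _ _ _ (fun x => 'J (gw (X t).1) x) (fun M => M i j)).
  by have [_] := gw_C1 (X t).1; exact.
exact: coord_continuous.
Qed.

End random_arguments.

(** The bounds of (A3) and (A4)(ii) hold only almost surely; pathwise estimates are proved under
    this predicate and then used outside a null set. *)
Definition regular_sample (C Lf : R) (p : W * V) : Prop :=
  [/\ forall y, enorm (grad (fv p.2) y) <= C,
      forall x, enorm ('J (gw p.1) x) <= C &
      forall y y', enorm (grad (fv p.2) y - grad (fv p.2) y') <= Lf * enorm (y - y')].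

Variables C Lf : R.
Hypotheses (C0 : 0 <= C) (Lf0 : 0 <= Lf).
Hypothesis reg : {ae mu, forall p, regular_sample C Lf p}.

Lemma chain_grad_bound p x y : regular_sample C Lf p -> enorm (G p x y) <= C ^+ 2.
Proof.
move=> [hf hg _]; rewrite (le_trans (enorm_mulmx _ _))// enorm_tr expr2.
by rewrite ler_pM ?enorm_ge0.
Qed.

Lemma chain_grad_lipschitz p x y y' : regular_sample C Lf p ->
  enorm (G p x y - G p x y') <= Lf * C * enorm (y - y').
Proof.
move=> [_ hg hl]; rewrite /G /chain_grad -mulmxBl.
rewrite (le_trans (enorm_mulmx _ _))// enorm_tr mulrAC.
by rewrite ler_pM ?enorm_ge0.
Qed.

Lemma grad_fv_integrable y i :
  mu.-integrable setT (EFin \o (fun p : W * V => grad (fv p.2) y 0 i)).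
Proof.
apply: (ae_bounded_integrable (grad_fv_measurable y i) C0).
by apply: filterS reg => p [hf _ _]; exact: le_trans (coord_le_enorm _ _) (hf y).
Qed.

(** The candidate gradient is the mean of the sample gradients. The remainders are at most Lf |z -
    y|^2 for almost every sample, so the bound passes through the integral. *)
Lemma mean_f_diff y : differentiable f y.
Proof.
have [] // := @quadratic_remainder_diff_real R m f y
  (\row_i \int[mu]_p grad (fv p.2) y 0 i) Lf.
move=> z.
have fi u : mu.-integrable setT (EFin \o (fun p : W * V => fv p.2 u)).
  exact: fv_int.
have gi i : mu.-integrable setT
    (EFin \o (fun p : W * V => grad (fv p.2) y 0 i * (z - y) 0 i)).
  by under eq_fun do rewrite mulrC; exact/integrable_Rscale/grad_fv_integrable.
have di : mu.-integrable setT
    (EFin \o (fun p : W * V => dotv (grad (fv p.2) y) (z - y))).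
  exact: integrable_Rsum.
have bi := integrable_RB (fi z) (fi y).
have -> : f z - f y - dotv (\row_i \int[mu]_p grad (fv p.2) y 0 i) (z - y) =
    \int[mu]_p (fv p.2 z - fv p.2 y - dotv (grad (fv p.2) y) (z - y)).
  rewrite (RintegralB measurableT bi di) (RintegralB measurableT (fi z) (fi y)).
  congr (_ - _); rewrite /dotv Rintegral_sum//.
  apply: eq_bigr => i _; rewrite mxE -RintegralZr//.
  exact: grad_fv_integrable.
apply: ae_norm_Rintegral_le; first exact: integrable_RB.
apply: filterS reg => p [_ _ hl]; apply: lipschitz_grad_remainder => // u.
by have [] := fv_C1 p.2.
Qed.

Lemma chain_grad_integrable x y i :
  mu.-integrable setT (EFin \o (fun p : W * V => G p x y 0 i)).
Proof.
apply: (@ae_bounded_integrable _ _ _ _ _ (C ^+ 2)); last 2 first.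
- exact: sqr_ge0.
- apply: filterS reg => p /chain_grad_bound h.
  exact: le_trans (coord_le_enorm _ _) (h x y).
exact: (measurable_chain_grad_comp (X := id)).
Qed.

Variable Lg : R.
Hypothesis g_smooth : forall x z,
  enorm (g x - g z - (x - z) *m 'J g z) <= Lg / 2 * enorm (x - z) ^+ 2.

(** The expression ['J g x] is defined for every g, so [g_smooth] presupposes no derivative; its
    quadratic bound forces one to exist. *)
Lemma mean_g_diff x : differentiable g x.
Proof. exact: quadratic_remainder_diff_vec (fun z => g_smooth z x). Qed.

Lemma compF_diff x : differentiable (compF mu fv gw) x.
Proof. by apply: (differentiable_comp (mean_g_diff x)); exact: mean_f_diff. Qed.

Lemma grad_compF x : grad (compF mu fv gw) x = chain_grad f g (g x) x.
Proof. by rewrite -grad_comp//; [exact: mean_g_diff|exact: mean_f_diff]. Qed.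

(** g is expanded around x' = (1 - t) x + t z. Since z - x' = (1 - 1/t) (x - x'), the remainder at z
    carries (1 - 1/t)^2. The absolute value covers t > 1, which happens for early steps 2 k^(-b). *)
Lemma mean_g_interpolation (t : R) (x x' z : 'rV[R]_n) : 0 < t ->
  z = (1 - t^-1) *: x + t^-1 *: x' ->
  enorm ((1 - t) *: g x + t *: g z - g x') <=
  (`|1 - t| + t * (1 - t^-1) ^+ 2) * (Lg / 2 * enorm (x' - x) ^+ 2).
Proof.
move=> t0 zE; have t_neq0 : t != 0 by rewrite gt_eqF.
have zx : z - x' = (1 - t^-1) *: (x - x').
  by apply/rowP => i; rewrite zE !mxE; ring.
have e0 : (1 - t) *: ((x - x') *m 'J g x') + t *: ((z - x') *m 'J g x') = 0.
  rewrite !scalemxAl -mulmxDl zx scalerA -scalerDl.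
  by rewrite (_ : _ + _ = 0) ?scale0r ?mul0mx//; field.
have -> : (1 - t) *: g x + t *: g z - g x' =
    (1 - t) *: (g x - g x' - (x - x') *m 'J g x') +
    t *: (g z - g x' - (z - x') *m 'J g x').
  move: e0; move: (_ *m _) (_ *m _) => u w /rowP e0.
  by apply/rowP => i; have := e0 i; rewrite !mxE; lra.
rewrite (le_trans (enormD _ _))// !enormZ (gtr0_norm t0) mulrDl lerD//.
  by rewrite ler_wpM2l// (enormC x').
rewrite -!mulrA ler_wpM2l ?(ltW t0)//; apply: (le_trans (g_smooth _ _)).
by rewrite zx sqr_enormZ (enormC x') le_eqVlt; apply/orP; left; apply/eqP; ring.
Qed.

Hypothesis unbiased : forall x y,
  \row_i \int[mu]_p G p x y 0 i = chain_grad f g y x.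

Lemma dotv_chain_grad_integrable v x y :
  mu.-integrable setT (EFin \o (fun p : W * V => dotv v (G p x y))).
Proof. by apply: integrable_Rsum => i; exact/integrable_Rscale/chain_grad_integrable. Qed.

Lemma dotv_chain_grad_mean v x y :
  \int[mu]_p dotv v (G p x y) = dotv v (chain_grad f g y x).
Proof.
rewrite /dotv Rintegral_sum; last first.
  by move=> i; exact/integrable_Rscale/chain_grad_integrable.
apply: eq_bigr => i _; rewrite RintegralZl//; last exact: chain_grad_integrable.
by rewrite -unbiased [in RHS]mxE.
Qed.

(** By unbiasedness |grad F|^2 is the mean of <grad F, G>, which is at most |grad F| C^2; then
    divide by |grad F|. *)
Lemma grad_compF_bound x : enorm (grad (compF mu fv gw) x) <= C ^+ 2.
Proof.
set v := grad _ x; have [v0|v0] := eqVneq (enorm v) 0; first by rewrite v0 sqr_ge0.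
have vp : 0 < enorm v by rewrite lt_neqAle eq_sym v0 enorm_ge0.
rewrite -(ler_pM2l vp) -expr2 -dotvv {2}/v grad_compF -dotv_chain_grad_mean.
apply: ae_Rintegral_le; first exact: dotv_chain_grad_integrable.
apply: filterS reg => p /chain_grad_bound h; rewrite (le_trans (dotv_le _ _))//.
by rewrite ler_wpM2l ?enorm_ge0.
Qed.

Variable sigma : R.
Hypothesis variance_le : forall x,
  (\int[mu]_p (enorm (gw p.1 x - g x) ^+ 2)%R%:E <= (sigma ^+ 2)%R%:E)%E.

(** A stands for what the past determines: it is constant in this integral, and the cross term
    vanishes because the noise is centered. *)
Lemma noise_second_moment (A : 'rV[R]_m) (t : R) x :
  (\int[mu]_p (enorm (A + t *: (gw p.1 x - g x)) ^+ 2)%R%:E <=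
   (enorm A ^+ 2 + t ^+ 2 * sigma ^+ 2)%R%:E)%E.
Proof.
have gi i : mu.-integrable setT (EFin \o (fun p : W * V => gw p.1 x 0 i)).
  exact: gw_int.
have ni i : mu.-integrable setT (EFin \o (fun p : W * V => (gw p.1 x - g x) 0 i)).
  under eq_fun do rewrite mxE [(- g x) 0 i]mxE.
  exact: integrable_RB (gi i) (integrable_prob_cst mu (g x 0 i)).
have n0 i : \int[mu]_p (gw p.1 x - g x) 0 i = 0.
  under eq_Rintegral do rewrite mxE [(- g x) 0 i]mxE.
  rewrite (RintegralB measurableT (gi i) (integrable_prob_cst mu (g x 0 i))).
  by rewrite Rintegral_prob_cst mxE subrr.
have n2 : mu.-integrable setT (EFin \o (fun p : W * V => enorm (gw p.1 x - g x) ^+ 2)).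
  apply/integrableP; split.
    apply/measurable_EFinP/measurable_sqr_enorm => i.
    by apply/measurable_EFinP; have /integrableP[] := ni i.
  under eq_integral do rewrite /= ger0_norm ?sqr_ge0//.
  by rewrite (le_lt_trans (variance_le x))// ltry.
have di : mu.-integrable setT (EFin \o (fun p : W * V => dotv A (gw p.1 x - g x))).
  by apply: integrable_Rsum => i; exact/integrable_Rscale.
have d0 : \int[mu]_p dotv A (gw p.1 x - g x) = 0.
  rewrite /dotv Rintegral_sum => [|i]; last exact/integrable_Rscale.
  by rewrite big1// => i _; rewrite RintegralZl// n0 mulr0.
have n2le : \int[mu]_p enorm (gw p.1 x - g x) ^+ 2 <= sigma ^+ 2.
  by rewrite -lee_fin EFin_Rintegral.
have dti := integrable_Rscale (2 * t) di.
have nti := integrable_Rscale (t ^+ 2) n2.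
have ci := integrable_prob_cst mu (enorm A ^+ 2).
have i1 := integrable_RD ci dti.
have e : (fun p : W * V => enorm (A + t *: (gw p.1 x - g x)) ^+ 2) =
    (fun p : W * V => enorm A ^+ 2 + 2 * t * dotv A (gw p.1 x - g x) +
       t ^+ 2 * enorm (gw p.1 x - g x) ^+ 2).
  by apply/funext => p; rewrite sqr_enormD dotvZr sqr_enormZ mulrA.
under eq_integral do rewrite (congr1 (@^~ _) e)/=.
rewrite -EFin_Rintegral; last exact: integrable_RD i1 nti.
rewrite lee_fin (RintegralD measurableT i1 nti) (RintegralD measurableT ci dti).
rewrite (RintegralZl _ measurableT di) (RintegralZl _ measurableT n2) d0 mulr0.
rewrite addr0 Rintegral_prob_cst lerD2l.
by rewrite ler_wpM2l ?sqr_ge0.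
Qed.

End composition.

(** * The iterates *)

Section iterates.
Context {R : realType} (n m : nat) (d dW dV : measure_display)
  (T : measurableType d) (W : measurableType dW) (V : measurableType dV)
  (P : probability T R) (mu : probability (W * V)%type R)
  (xi : nat -> {RV P >-> (W * V)%type})
  (fv : V -> 'rV[R]_m -> R) (gw : W -> 'rV[R]_n -> 'rV[R]_m).
Hypothesis fv_C1 : forall v, C1_real (fv v).
Hypothesis gw_C1 : forall w, C1_vec (gw w).
Hypothesis fv_int : forall y, mu.-integrable setT (fun p => (fv p.2 y)%:E).
Hypothesis gw_int : forall x i, mu.-integrable setT (fun p => (gw p.1 x 0 i)%:E).
Hypothesis xi_indep : mutually_independent [set k | (0 < k)%N] xi.
Hypothesis xi_law : forall k, (0 < k)%N -> forall A, measurable A ->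
  distribution P (xi k) A = mu A.

Let f := mean_f mu fv.
Let g := mean_g mu gw.
Let F := compF mu fv gw.
Let G (p : W * V) (x : 'rV[R]_n) (y : 'rV[R]_m) := chain_grad (fv p.2) (gw p.1) y x.

Variables (alpha beta : nat -> R) (x1 : 'rV[R]_n) (y1 : 'rV[R]_m).
Variables (x z : nat -> T -> 'rV[R]_n) (y : nat -> T -> 'rV[R]_m).
Hypothesis x_init : forall t, x 1%N t = x1.
Hypothesis y_init : forall t, y 1%N t = y1.
Hypothesis x_step : forall k t, (0 < k)%N ->
  x k.+1 t = x k t - alpha k *: G (xi k t) (x k t) (y k t).
Hypothesis z_step : forall k t, (0 < k)%N ->
  z k.+1 t = (1 - (beta k)^-1) *: x k t + (beta k)^-1 *: x k.+1 t.
Hypothesis y_step : forall k t, (0 < k)%N ->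
  y k.+1 t = (1 - beta k) *: y k t + beta k *: gw (xi k.+1 t).1 (z k.+1 t).

(** The offset is essential: x_(k+1) uses samples up to k, whereas y_(k+1) already uses sample
    k+1. *)
Lemma iterates_past_measurable k :
  (forall i, measurable_fun setT ((fun t => x k.+1 t 0 i) : past xi k -> R)) /\
  (forall i, measurable_fun setT ((fun t => y k.+1 t 0 i) : past xi k.+1 -> R)).
Proof.
elim: k => [|k [mx my]].
  split=> i; under eq_fun do rewrite ?x_init ?y_init; exact: measurable_cst.
have mx' i : measurable_fun setT ((fun t => x k.+1 t 0 i) : past xi k.+1 -> R).
  exact: measurable_fun_pastS (mx i).
have mxi : measurable_fun setT (xi k.+1 : past xi k.+1 -> W * V).
  by apply: past_sample_measurable; rewrite ltn0Sn/=.
have mx2 i : measurable_fun setT ((fun t => x k.+2 t 0 i) : past xi k.+1 -> R).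
  under eq_fun do rewrite x_step//.
  apply: (@measurable_coordB _ _ (past xi k.+1)) => //.
  apply: (@measurable_coordZ _ _ (past xi k.+1)) => j.
  exact: measurable_chain_grad_comp.
split=> // i.
have mx1 j : measurable_fun setT ((fun t => x k.+1 t 0 j) : past xi k.+2 -> R).
  exact: measurable_fun_pastS (mx' j).
have mx3 j : measurable_fun setT ((fun t => x k.+2 t 0 j) : past xi k.+2 -> R).
  exact: measurable_fun_pastS (mx2 j).
have my1 j : measurable_fun setT ((fun t => y k.+1 t 0 j) : past xi k.+2 -> R).
  exact: measurable_fun_pastS (my j).
have mz j : measurable_fun setT ((fun t => z k.+2 t 0 j) : past xi k.+2 -> R).
  under eq_fun do rewrite z_step//.
  by apply: (@measurable_coordD _ _ (past xi k.+2));
    apply: (@measurable_coordZ _ _ (past xi k.+2)).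
under eq_fun do rewrite y_step//.
apply: (@measurable_coordD _ _ (past xi k.+2));
    apply: (@measurable_coordZ _ _ (past xi k.+2)) => // l.
apply: measurable_gw_comp => //.
by apply: past_sample_measurable; rewrite ltn0Sn/=.
Qed.

Variables C Lf Lg LF sigma Fmin : R.
Hypotheses (C0 : 0 <= C) (Lf0 : 0 <= Lf) (Lg0 : 0 <= Lg) (LF0 : 0 <= LF).
Hypothesis reg : {ae mu, forall p, regular_sample fv gw C Lf p}.
Hypothesis g_smooth : forall x z,
  enorm (g x - g z - (x - z) *m 'J g z) <= Lg / 2 * enorm (x - z) ^+ 2.
Hypothesis F_smooth : forall x z,
  F z - F x <= dotv (grad F x) (z - x) + LF / 2 * enorm (z - x) ^+ 2.
Hypothesis F_lower : forall x, Fmin <= F x.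
Hypothesis unbiased : forall x y,
  \row_i \int[mu]_p G p x y 0 i = chain_grad f g y x.
Hypothesis variance_le : forall x,
  (\int[mu]_p (enorm (gw p.1 x - g x) ^+ 2)%R%:E <= (sigma ^+ 2)%R%:E)%E.
Hypothesis alpha_itv : forall k, (0 < k)%N -> 0 < alpha k <= 1.
Hypothesis beta_gt0 : forall k, (0 < k)%N -> 0 < beta k.

Let F_diff u : differentiable F u.
Proof. by apply: (compF_diff fv_C1 fv_int C0 Lf0 reg g_smooth). Qed.

Let g_continuous : continuous g.
Proof. by move=> u; apply: differentiable_continuous; exact: (mean_g_diff g_smooth). Qed.

Let gradF_bound u : enorm (grad F u) <= C ^+ 2.
Proof. exact: (grad_compF_bound fv_C1 gw_C1 fv_int gw_int C0 Lf0 reg g_smooth unbiased). Qed.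

Let g_measurable dU (U : measurableType dU) (v : U -> 'rV[R]_n) :
  (forall i, measurable_fun setT (fun t => v t 0 i)) ->
  forall i, measurable_fun setT (fun t => g (v t) 0 i).
Proof.
move=> mv i; apply: (measurable_cont_comp (h := fun u => g u 0 i)) => // u.
apply: (@continuous_comp _ _ _ g (fun M => M 0 i)); first exact: g_continuous.
exact: coord_continuous.
Qed.

Let x_measurable k i : measurable_fun setT (fun t => x k.+1 t 0 i).
Proof. by have [mx _] := iterates_past_measurable k; exact: measurable_fun_past (mx i). Qed.

Let y_measurable k i : measurable_fun setT (fun t => y k.+1 t 0 i).
Proof. by have [_ my] := iterates_past_measurable k; exact: measurable_fun_past (my i). Qed.

Lemma all_samples_regular :
  {ae P, forall t, forall k, (0 < k)%N -> regular_sample fv gw C Lf (xi k t)}.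
Proof.
apply/ae_foralln => -[|k]; first exact: nearW.
have := ae_law (xi_law (ltn0Sn k)) reg.
by apply: filterS => t ht _.
Qed.

Lemma iterate_move k t : (0 < k)%N -> regular_sample fv gw C Lf (xi k t) ->
  enorm (x k.+1 t - x k t) <= alpha k * C ^+ 2.
Proof.
move=> k0 h; have /andP[a0 _] := alpha_itv k0.
rewrite x_step// addrAC subrr add0r enormN enormZ gtr0_norm// ler_pM2l//.
exact: (chain_grad_bound _ _ h).
Qed.

(** This bound grows with k; it serves only to make F(x_k) integrable for each k. *)
Lemma iterate_range k t :
  (forall k, (0 < k)%N -> regular_sample fv gw C Lf (xi k t)) ->
  enorm (x k.+1 t - x1) <= k%:R * C ^+ 2.
Proof.
move=> h; elim: k => [|k IH]; first by rewrite x_init subrr enorm0 mul0r.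
have -> : x k.+2 t - x1 = (x k.+2 t - x k.+1 t) + (x k.+1 t - x1).
  by rewrite addrA subrK.
rewrite (le_trans (enormD _ _))// -natr1 mulrDl mul1r [leRHS]addrC lerD//.
apply: (le_trans (iterate_move (ltn0Sn k) (h _ (ltn0Sn k)))).
by have /andP[_ a1] := alpha_itv (ltn0Sn k); rewrite ler_piMl// sqr_ge0.
Qed.

Lemma F_iterate_integrable k : P.-integrable setT (EFin \o (fun t => F (x k.+1 t))).
Proof.
pose B := k%:R * C ^+ 2.
(* On the ball of radius [B] around x1, F lies between [Fmin] and the quadratic upper bound of
   [F_smooth]; [c] dominates both in absolute value. *)
pose c := `|Fmin| + `|F x1 + C ^+ 2 * B + LF / 2 * B ^+ 2|.
have B0 : 0 <= B by rewrite mulr_ge0// sqr_ge0.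
apply: (@ae_bounded_integrable _ _ _ _ _ c).
- apply: measurable_cont_comp => // u; exact: differentiable_continuous.
- exact: addr_ge0.
- apply: filterS all_samples_regular => t /(iterate_range k) hx.
  have hl := F_lower (x k.+1 t).
  have hu : F (x k.+1 t) <= F x1 + C ^+ 2 * B + LF / 2 * B ^+ 2.
    rewrite -addrA -lerBlDl (le_trans (F_smooth _ _))// lerD//.
      by rewrite (le_trans (dotv_le _ _))// ler_pM ?enorm_ge0.
    by rewrite ler_wpM2l ?divr_ge0// ler_pXn2r ?nnegrE ?enorm_ge0.
  rewrite ler_norml; apply/andP; split.
    by rewrite lerNl (le_trans _ (_ : - Fmin <= c))// ?lerN2//
      /c (le_trans (ler_norm _))// normrN lerDl.
  by rewrite (le_trans hu)// /c (le_trans (ler_norm _))// lerDr.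
Qed.

Lemma sqr_gradF_integrable k :
  P.-integrable setT (EFin \o (fun t => enorm (grad F (x k.+1 t)) ^+ 2)).
Proof.
apply: (@ae_bounded_integrable _ _ _ _ _ ((C ^+ 2) ^+ 2)).
- by apply: measurable_sqr_enorm => i; exact: measurable_grad_comp.
- exact: sqr_ge0.
- by apply: nearW => t; rewrite ger0_norm ?sqr_ge0// ler_pXn2r ?nnegrE ?enorm_ge0 ?sqr_ge0.
Qed.

(* x_(k+1) depends only on the samples before xi_(k+1); evaluating the inner
   argument at g(x_(k+1)) rather than at y_(k+1), which does depend on
   xi_(k+1), makes the stochastic gradient conditionally unbiased. *)
Lemma mean_dotv_ideal_gradient k :
  let D t := dotv (grad F (x k.+1 t)) (G (xi k.+1 t) (x k.+1 t) (g (x k.+1 t))) in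
  P.-integrable setT (EFin \o D) /\
  \int[P]_t D t = \int[P]_t enorm (grad F (x k.+1 t)) ^+ 2.
Proof.
move=> D.
pose h (q : past xi k * (W * V)) : \bar R :=
  (dotv (grad F (x k.+1 q.1)) (G q.2 (x k.+1 q.1) (g (x k.+1 q.1))))%:E.
have [mx _] := iterates_past_measurable k.
have mx1 i : measurable_fun setT
    (fun q : past xi k * (W * V) => x k.+1 q.1 0 i).
  exact: measurableT_comp (mx i) (@measurable_fst _ _ (past xi k) (W * V)%type).
have mh : measurable_fun setT h.
  apply/measurable_EFinP; apply: measurable_dotv => i.
    exact: measurable_grad_comp.
  apply: measurable_chain_grad_comp => //.
  exact: g_measurable.
have iD : P.-integrable setT (EFin \o D).
  apply: (@ae_bounded_integrable _ _ _ _ _ (C ^+ 2 * C ^+ 2)).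
  - apply: measurable_dotv => i; first exact: measurable_grad_comp.
    by apply: measurable_chain_grad_comp => //; exact: g_measurable.
  - by rewrite mulr_ge0// sqr_ge0.
  - apply: filterS all_samples_regular => t /(_ _ (ltn0Sn k)) hG.
    rewrite (le_trans (dotv_le_enorm _ _))// ler_pM ?enorm_ge0//.
    exact: (chain_grad_bound _ _ hG).
split=> //.
have := integral_freeze (Y := @past_id _ _ _ _ _ _ xi k) (X := xi k.+1)
  (@past_indep _ _ _ _ _ _ _ _ xi_indep xi_law k) mh iD.
move=> [_]; rewrite /h/= => hE.
rewrite /Rintegral hE; congr fine; apply: eq_integral => t _.
(* With the past frozen, x_(k+1) is a constant vector: (A1) applies at y = g(x_(k+1)), and the chain
   rule identifies the mean direction with grad F. *)
have hi := dotv_chain_grad_integrable fv_C1 gw_C1 fv_int gw_int reg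
  (grad F (x k.+1 t)) (x k.+1 t) (g (x k.+1 t)).
have hm := dotv_chain_grad_mean fv_C1 gw_C1 fv_int gw_int reg unbiased
  (grad F (x k.+1 t)) (x k.+1 t) (g (x k.+1 t)).
rewrite /past_id; apply: (etrans (esym (EFin_Rintegral hi))); rewrite hm.
congr _%:E; rewrite -dotvv; congr dotv.
by rewrite /F (grad_compF fv_C1 fv_int C0 Lf0 reg g_smooth).
Qed.

Let e k t := y k t - g (x k t).
(** The part of e_(k+1) known before sample k+1 is drawn: e_(k+1) = A_k + beta_k (g_w(z_(k+1)) -
    g(z_(k+1))). *)
Let A k t := (1 - beta k) *: y k t + beta k *: g (z k.+1 t) - g (x k.+1 t).
Let drift_cst k := (`|1 - beta k| + beta k * (1 - (beta k)^-1) ^+ 2) *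
  (Lg / 2 * (alpha k * C ^+ 2) ^+ 2).

Let A_drift k t : A k t = (1 - beta k) *: e k t +
  ((1 - beta k) *: g (x k t) + beta k *: g (z k.+1 t) - g (x k.+1 t)).
Proof. by rewrite /A /e scalerBr !addrA subrK. Qed.

Let drift_bound k t : (0 < k)%N -> regular_sample fv gw C Lf (xi k t) ->
  enorm ((1 - beta k) *: g (x k t) + beta k *: g (z k.+1 t) - g (x k.+1 t))
    <= drift_cst k.
Proof.
move=> k0 h; have b0 := beta_gt0 k0.
apply: (le_trans (mean_g_interpolation g_smooth b0 (z_step t k0))).
rewrite ler_wpM2l ?addr_ge0 ?(mulr_ge0 (ltW b0)) ?sqr_ge0//.
rewrite ler_wpM2l ?divr_ge0// ler_pXn2r ?nnegrE ?enorm_ge0 ?iterate_move//.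
by have /andP[a0 _] := alpha_itv k0; rewrite mulr_ge0 ?sqr_ge0// ltW.
Qed.

Let e_measurable k i : measurable_fun setT (fun t => e k.+1 t 0 i).
Proof.
by apply: measurable_coordB => j; [exact: y_measurable|exact: g_measurable].
Qed.

Let z_measurable k i :
  measurable_fun setT ((fun t => z k.+2 t 0 i) : past xi k.+1 -> R).
Proof.
under eq_fun do rewrite z_step//.
have [mx _] := iterates_past_measurable k.
have [mx' _] := iterates_past_measurable k.+1.
apply: (@measurable_coordD _ _ (past xi k.+1));
  apply: (@measurable_coordZ _ _ (past xi k.+1)) => // j.
exact: measurable_fun_pastS (mx j).
Qed.

Let A_measurable k i :
  measurable_fun setT ((fun t => A k.+1 t 0 i) : past xi k.+1 -> R).
Proof.
have [_ my] := iterates_past_measurable k.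
have [mx _] := iterates_past_measurable k.+1.
apply: (@measurable_coordB _ _ (past xi k.+1)); last exact: g_measurable.
by apply: (@measurable_coordD _ _ (past xi k.+1));
  apply: (@measurable_coordZ _ _ (past xi k.+1)) => //;
  apply: g_measurable => j; exact: z_measurable.
Qed.

(** Freeze the past up to k+1 and integrate the new sample out. The integrals are extended-real
    because integrability of the left side is deduced from this very inequality. *)
Lemma tracking_error_step k :
  (\int[P]_t (enorm (e k.+2 t) ^+ 2)%:E <=
   \int[P]_t (enorm (A k.+1 t) ^+ 2)%:E + (beta k.+1 ^+ 2 * sigma ^+ 2)%:E)%E.
Proof.
pose h (q : past xi k.+1 * (W * V)) : \bar R :=
  (enorm (A k.+1 q.1 + beta k.+1 *: (gw q.2.1 (z k.+2 q.1) - g (z k.+2 q.1))) ^+ 2)%:E.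
have mfst i (v : T -> 'rV[R]_i) :
    (forall j, measurable_fun setT ((fun t => v t 0 j) : past xi k.+1 -> R)) ->
    forall j, measurable_fun setT (fun q : past xi k.+1 * (W * V) => v q.1 0 j).
  move=> mv j.
  exact: measurableT_comp (mv j) (@measurable_fst _ _ (past xi k.+1) (W * V)%type).
have mz := mfst _ _ (@z_measurable k).
have mA := mfst _ _ (@A_measurable k).
have mh : measurable_fun setT h.
  apply/measurable_EFinP/measurable_sqr_enorm; apply: measurable_coordD => //.
  apply: measurable_coordZ; apply: measurable_coordB; last exact: g_measurable.
  by move=> i; apply: measurable_gw_comp.
have h0 u : (0 <= h u)%E by rewrite lee_fin sqr_ge0.
have hE := ge0_integral_freeze (Y := @past_id _ _ _ _ _ _ xi k.+1) (X := xi k.+2)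
  (@past_indep _ _ _ _ _ _ _ _ xi_indep xi_law k.+1) mh h0.
have -> : (\int[P]_t (enorm (e k.+2 t) ^+ 2)%:E =
    \int[P]_t \int[mu]_p h (t, p))%E.
  rewrite -[RHS]hE; apply: eq_integral => t _.
  rewrite /h /= /past_id; congr (enorm _ ^+ 2)%:E.
  by rewrite /e y_step// /A; apply/rowP => i; rewrite !mxE; ring.
have mF : measurable_fun setT ((fun t => \int[mu]_p h (t, p))%E : T -> \bar R).
  exact: measurable_fun_past (measurable_fun_fubini_tonelli_F (m2 := mu) h mh h0).
have mA2 : measurable_fun setT (fun t => (enorm (A k.+1 t) ^+ 2)%:E).
  apply/measurable_EFinP/measurable_sqr_enorm => i.
  exact: measurable_fun_past (A_measurable i).
apply: (@le_trans _ _ (\int[P]_t ((enorm (A k.+1 t) ^+ 2)%:E +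
    (beta k.+1 ^+ 2 * sigma ^+ 2)%:E))%E).
  apply: ge0_le_integral => //.
  - by move=> t _; apply: integral_ge0 => p _; rewrite lee_fin sqr_ge0.
  - exact: emeasurable_funD.
  - move=> t _; rewrite -EFinD.
    exact: (noise_second_moment gw_int variance_le (A k.+1 t) (beta k.+1) (z k.+2 t)).
rewrite ge0_integralD//.
- by rewrite integral_cst//= probability_setT mule1.
- by move=> t _; rewrite lee_fin sqr_ge0.
- by move=> t _; rewrite lee_fin mulr_ge0 ?sqr_ge0.
Qed.

Let sqr_A_integrable k :
  P.-integrable setT (EFin \o (fun t => enorm (e k.+1 t) ^+ 2)) ->
  P.-integrable setT (EFin \o (fun t => enorm (A k.+1 t) ^+ 2)).
Proof.
move=> ie.
apply: (@ae_dominated_integrable _ _ _ _ _ (fun t =>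
  2 * (1 - beta k.+1) ^+ 2 * enorm (e k.+1 t) ^+ 2 + 2 * drift_cst k.+1 ^+ 2)).
- by apply: measurable_sqr_enorm => i; exact: measurable_fun_past (A_measurable i).
- exact: (integrable_RD (integrable_Rscale _ ie) (integrable_prob_cst _ _)).
- apply: filterS all_samples_regular => t /(_ _ (ltn0Sn k)) ht.
  rewrite ger0_norm ?sqr_ge0// A_drift (le_trans (sqr_enormD_le _ _))//.
  rewrite sqr_enormZ mulrA lerD// ler_wpM2l//.
  have hd := drift_bound (ltn0Sn k) ht.
  by rewrite ler_pXn2r ?nnegrE ?enorm_ge0// (le_trans (enorm_ge0 _) hd).
Qed.

Lemma tracking_error_integrable k :
  P.-integrable setT (EFin \o (fun t => enorm (e k.+1 t) ^+ 2)).
Proof.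
elim: k => [|k IH].
  rewrite (_ : (fun t => _) = fun=> enorm (y1 - g x1) ^+ 2).
    exact: integrable_prob_cst.
  by apply/funext => t; rewrite /e x_init y_init.
have /integrableP[mA iA] := sqr_A_integrable IH.
apply/integrableP; split.
  by apply/measurable_EFinP/measurable_sqr_enorm => i; exact: e_measurable.
under eq_integral do rewrite /= ger0_norm ?sqr_ge0//.
apply: (le_lt_trans (tracking_error_step k)); apply: lte_add_pinfty; last exact: ltry.
by under eq_integral do rewrite /= -[_ ^+ 2]ger0_norm ?sqr_ge0//.
Qed.

Let u k := \int[P]_t enorm (e k t) ^+ 2.

Lemma tracking_error_recursion k : (0 < k)%N -> beta k <= 1 ->
  u k.+1 <= (1 - beta k) * u k + (Lg * (alpha k * C ^+ 2) ^+ 2) ^+ 2 / beta k ^+ 3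
    + beta k ^+ 2 * sigma ^+ 2.
Proof.
case: k => // k _ b1; have b0 := beta_gt0 (ltn0Sn k).
have ie := tracking_error_integrable k.
have iA := sqr_A_integrable ie.
have h1 : u k.+2 <= \int[P]_t enorm (A k.+1 t) ^+ 2 + beta k.+1 ^+ 2 * sigma ^+ 2.
  rewrite -lee_fin EFinD (EFin_Rintegral (tracking_error_integrable k.+1)).
  by rewrite (EFin_Rintegral iA); exact: tracking_error_step.
apply: (le_trans h1); rewrite lerD2r.
set c := _ / _.
have -> : (1 - beta k.+1) * u k.+1 + c =
    \int[P]_t ((1 - beta k.+1) * enorm (e k.+1 t) ^+ 2 + c).
  rewrite (RintegralD measurableT (integrable_Rscale _ ie) (integrable_prob_cst _ _)).
  by rewrite (RintegralZl _ measurableT ie) Rintegral_prob_cst.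
apply: (ae_le_Rintegral iA
  (integrable_RD (integrable_Rscale _ ie) (integrable_prob_cst _ _))).
apply: filterS all_samples_regular => t /(_ _ (ltn0Sn k)) ht.
rewrite A_drift; set B := (X in _ + X).
(* For beta <= 1 the factor in [drift_cst] collapses to (1 - beta) / beta, so the drift is below Lg
   q / beta. *)
have hB : enorm B <= Lg * (alpha k.+1 * C ^+ 2) ^+ 2 / beta k.+1.
  apply: (le_trans (drift_bound (ltn0Sn k) ht)); rewrite /drift_cst.
  rewrite ger0_norm ?subr_ge0//.
  set q := (alpha k.+1 * C ^+ 2) ^+ 2; have q0 : 0 <= q by exact: sqr_ge0.
  rewrite -subr_ge0.
  have -> : Lg * q / beta k.+1 - (1 - beta k.+1 + beta k.+1 * (1 - (beta k.+1)^-1) ^+ 2) *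
     (Lg / 2 * q) = Lg * q * (1 + beta k.+1) / (2 * beta k.+1).
    by field; rewrite gt_eqF.
  have b0' := ltW b0; have b2 : 0 <= 1 + beta k.+1 by exact: addr_ge0.
  by rewrite divr_ge0 ?(mulr_ge0 _ b0')// mulr_ge0 ?b2// mulr_ge0.
(* Written this way, the sum is a convex combination with weights 1 - beta and beta. *)
have -> : B = beta k.+1 *: ((beta k.+1)^-1 *: B).
  by rewrite scalerA mulfV ?gt_eqF// scale1r.
apply: (le_trans (sqr_enormD_convex _ _ _)); first by rewrite (ltW b0).
rewrite lerD2l sqr_enormZ mulrA.
have -> : c = beta k.+1 * (beta k.+1)^-1 ^+ 2 *
    (Lg * (alpha k.+1 * C ^+ 2) ^+ 2 / beta k.+1) ^+ 2.
  by rewrite /c; field; rewrite gt_eqF.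
rewrite ler_wpM2l ?(mulr_ge0 (ltW b0)) ?sqr_ge0//.
by rewrite ler_pXn2r ?nnegrE ?enorm_ge0// (le_trans (enorm_ge0 _) hB).
Qed.

Let Fbar k := \int[P]_t F (x k t).
Let Gbar k := \int[P]_t enorm (grad F (x k t)) ^+ 2.

(** The replacement error is at most |grad F| Lf C |e_k|, and Young's inequality splits it into
    |grad F|^2 / 2, absorbed on the left, and the tracking error. C^4 bounds the squared step
    direction. *)
Lemma descent_step k : (0 < k)%N ->
  Gbar k <= 2 / alpha k * (Fbar k - Fbar k.+1) + Lf ^+ 2 * C ^+ 2 * u k +
    LF * C ^+ 4 * alpha k.
Proof.
case: k => // k _; have /andP[a0 a1] := alpha_itv (ltn0Sn k).
have [iD eD] := mean_dotv_ideal_gradient k.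
have iF := F_iterate_integrable k.
have iG := sqr_gradF_integrable k.
have ie := tracking_error_integrable k.
apply: descent_rearrange => //.
pose c := LF * C ^+ 4 / 2 * alpha k.+1 ^+ 2.
pose D t := dotv (grad F (x k.+1 t)) (G (xi k.+1 t) (x k.+1 t) (g (x k.+1 t))).
have ie' := integrable_Rscale (Lf ^+ 2 * C ^+ 2) ie.
have i1 := integrable_RB iF (integrable_Rscale (alpha k.+1) iD).
have i2 := integrable_RD i1 (integrable_Rscale (alpha k.+1 / 2) iG).
have i3 := integrable_RD i2 (integrable_Rscale (alpha k.+1 / 2) ie').
have i4 := integrable_RD i3 (integrable_prob_cst P c).
have -> : Fbar k.+1 - alpha k.+1 * Gbar k.+1 + alpha k.+1 / 2 * Gbar k.+1 +
    alpha k.+1 / 2 * (Lf ^+ 2 * C ^+ 2 * u k.+1) + c =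
  \int[P]_t (F (x k.+1 t) - alpha k.+1 * D t +
    alpha k.+1 / 2 * enorm (grad F (x k.+1 t)) ^+ 2 +
    alpha k.+1 / 2 * (Lf ^+ 2 * C ^+ 2 * enorm (e k.+1 t) ^+ 2) + c).
  rewrite (RintegralD measurableT i3 (integrable_prob_cst P c)).
  rewrite (RintegralD measurableT i2 (integrable_Rscale _ ie')).
  rewrite (RintegralD measurableT i1 (integrable_Rscale _ iG)).
  rewrite (RintegralB measurableT iF (integrable_Rscale _ iD)).
  rewrite (RintegralZl _ measurableT iD) (RintegralZl _ measurableT iG).
  rewrite (RintegralZl _ measurableT ie') (RintegralZl _ measurableT ie).
  by rewrite Rintegral_prob_cst eD.
apply: (ae_le_Rintegral (F_iterate_integrable k.+1) i4).
apply: filterS all_samples_regular => t /(_ _ (ltn0Sn k)) ht.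
pose phi := grad F (x k.+1 t); pose S := G (xi k.+1 t) (x k.+1 t) (y k.+1 t).
have hF := F_smooth (x k.+1 t) (x k.+2 t).
have xx : x k.+2 t - x k.+1 t = - (alpha k.+1 *: S).
  by rewrite x_step// addrAC subrr add0r.
rewrite xx dotvNr dotvZr enormN sqr_enormZ in hF.
have hS : enorm S ^+ 2 <= C ^+ 4.
  rewrite (_ : C ^+ 4 = (C ^+ 2) ^+ 2); last by rewrite -exprM.
  by rewrite ler_pXn2r ?nnegrE ?enorm_ge0 ?sqr_ge0//; exact: (chain_grad_bound _ _ ht).
have hdiff : enorm (G (xi k.+1 t) (x k.+1 t) (g (x k.+1 t)) - S) <=
    Lf * C * enorm (e k.+1 t).
  by rewrite /e enormC; exact: (chain_grad_lipschitz _ _ _ ht).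
have hdot : D t - dotv phi S <=
    (enorm phi ^+ 2 + Lf ^+ 2 * C ^+ 2 * enorm (e k.+1 t) ^+ 2) / 2.
  rewrite /D -/phi -dotvBr (le_trans (dotv_le _ _))//.
  apply: (@le_trans _ _ (enorm phi * (Lf * C * enorm (e k.+1 t)))).
    by rewrite ler_wpM2l ?enorm_ge0.
  by rewrite (le_trans (mul_le_half_sqrD _ _))// !exprMn.
have := descent_pointwise a0 LF0 hF hdot hS.
by rewrite /c mulrAC [LF * _ / 2]mulrAC [LF / 2 * _ * _]mulrAC.
Qed.

End iterates.

(** * Assembling the rates *)

Lemma is_prox_zero {R : realType} n (alpha : R) (r : 'rV[R]_n -> \bar R) u x :
  (forall v, r v = 0%E) -> is_prox alpha r u x -> x = u.
Proof.
move=> r0 /(_ u); rewrite !r0 !mule0 !adde0 lee_fin subrr enorm0 expr0n/= mulr0.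
rewrite pmulr_rle0// => h; apply/eqP; rewrite -subr_eq0; apply/eqP/enorm_eq0/eqP.
by rewrite -sqrf_eq0 eq_le h sqr_ge0.
Qed.

Theorem theorem1 (R : realType) (n m : nat) (d dW dV : measure_display)
    (T : measurableType d) (W : measurableType dW) (V : measurableType dV)
    (P : probability T R) (mu : probability (W * V)%type R)
    (xi : nat -> {RV P >-> (W * V)%type})
    (fv : V -> 'rV[R]_m -> R) (gw : W -> 'rV[R]_n -> 'rV[R]_m)
    (r : 'rV[R]_n -> \bar R) (LF Lf Lg a b : R)
    (x1 : 'rV[R]_n) (y1 : 'rV[R]_m)
    (x z : nat -> T -> 'rV[R]_n) (y : nat -> T -> 'rV[R]_m)
    (hproblem : composition_problem mu fv gw r)
    (hsamples : sampling_oracle mu xi)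
    (hA1 : unbiased_oracle mu xi fv gw)
    (hA2 : bounded_variance mu gw)
    (hA3 : bounded_gradients mu fv gw r)
    (hLF : 0 <= LF) (hLf : 0 <= Lf) (hLg : 0 <= Lg)
    (hA4 : smoothness mu fv gw LF Lf Lg)
    (hr : forall u, r u = 0%E)
    (ha : 0 < a < 1) (hb : 0 < b < 1)
    (hrun : asc_pg xi fv gw r (fun k => k%:R `^ (- a))
              (fun k => 2 * k%:R `^ (- b)) x1 y1 x z y)
    (hbounded : exists M : R, forall k, (0 < k)%N ->
       ('E_P[fun t => compF mu fv gw (x k t)] <= M%:E)%E) :
  let A := avg_sq_grad P (compF mu fv gw) x in
  [/\ le_bigO A (rate Lf Lg a b),
      Lg != 0 -> Lf != 0 -> a = 5 / 9 -> b = 4 / 9 ->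
        le_bigO A (fun K => K%:R `^ (- (4 / 9))) &
      Lg = 0 \/ Lf = 0 ->
        (forall a' b' : R, 0 < a' < 1 -> 0 < b' < 1 ->
           le_bigO (fun K => (rate Lf Lg (1 / 2) (1 / 2) K)%:E)
                   (rate Lf Lg a' b')) /\
        (a = 1 / 2 -> b = 1 / 2 ->
           le_bigO A (fun K => K%:R `^ (- (1 / 2))))].
Proof.
move=> A.
have [[fv_C1 gw_C1 fv_int gw_int _] [xs xs_min]] := hproblem.
have [xi_indep xi_law] := hsamples.
have [sigma hsigma] := hA2.
have [C1 [hgf hgJ _]] := hA3.
have [F_smooth hlip g_smooth] := hA4.
have [hinit hstep] := hrun.
have [M hM] := hbounded.
pose C := `|C1|; have C0 : 0 <= C by exact: normr_ge0.
have C1C : C1 <= C by exact: ler_norm.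
have reg : {ae mu, forall p, regular_sample fv gw C Lf p}.
  apply: filterS3 hgf hgJ hlip => p h1 h2 h3; split=> // [v|v].
    exact: le_trans (h1 v) C1C.
  exact: le_trans (h2 v) C1C.
have x_init t : x 1%N t = x1 by have [] := hinit t.
have y_init t : y 1%N t = y1 by have [] := hinit t.
have x_step k t : (0 < k)%N -> x k.+1 t = x k t - k%:R `^ (- a) *:
    chain_grad (fv (xi k t).2) (gw (xi k t).1) (y k t) (x k t).
  by move=> k0; have [/(is_prox_zero hr)] := hstep k t k0.
have z_step k t : (0 < k)%N -> z k.+1 t = (1 - (2 * k%:R `^ (- b))^-1) *: x k t +
    (2 * k%:R `^ (- b))^-1 *: x k.+1 t.
  by move=> k0; have [] := hstep k t k0.
have y_step k t : (0 < k)%N -> y k.+1 t = (1 - 2 * k%:R `^ (- b)) *: y k t +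
    (2 * k%:R `^ (- b)) *: gw (xi k.+1 t).1 (z k.+1 t).
  by move=> k0; have [] := hstep k t k0.
have F_lower v : compF mu fv gw xs <= compF mu fv gw v.
  by have := xs_min v; rewrite !hr !adde0 lee_fin.
(* (A1) speaks of the samples; it is moved to [mu] through the law of sample 1. *)
have unbiased u v : \row_i \int[mu]_p chain_grad (fv p.2) (gw p.1) v u 0 i =
    chain_grad (mean_f mu fv) (mean_g mu gw) v u.
  have [/(_ u v) <- _] := hA1 1%N isT; apply/rowP => i; rewrite !mxE.
  have mG : measurable_fun setT
      (fun p : W * V => (chain_grad (fv p.2) (gw p.1) v u 0 i)%:E).
    apply/measurable_EFinP.
    exact: (measurable_chain_grad_comp fv_C1 gw_C1 fv_int gw_int (X := id)).
  by rewrite /Rintegral -(integral_law (xi_law 1%N isT) mG).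
have [a0 a1] := andP ha.
pose alpha k : R := k%:R `^ (- a); pose beta k : R := 2 * k%:R `^ (- b).
have alpha_itv k : (0 < k)%N -> 0 < alpha k <= 1.
  move=> k0; rewrite /alpha powR_gt0 ?ltr0n//= -[leRHS](powRr0 k%:R) ler_powR ?ler1n//.
  by rewrite oppr_le0 ltW.
have beta_gt0 k : (0 < k)%N -> 0 < beta k.
  by move=> k0; rewrite /beta mulr_gt0 ?powR_gt0 ?ltr0n.
pose u k := \int[P]_t enorm (y k t - mean_g mu gw (x k t)) ^+ 2.
pose Fbar k := \int[P]_t compF mu fv gw (x k t).
pose Gbar k := \int[P]_t enorm (grad (compF mu fv gw) (x k t)) ^+ 2.
(* With beta = 2 k^(-b), the cube gives the 8 in [B1] and the square the 4 in [B2]; C^8 is (C^2)^4,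
   from the fourth power of the step length. *)
pose s := 4 * b - 4 * a; pose B1 := Lg ^+ 2 * C ^+ 8 / 8; pose B2 := 4 * sigma ^+ 2.
have u_rec k : (0 < k)%N -> 2 * k%:R `^ (- b) <= 1 ->
    u k.+1 <= (1 - 2 * k%:R `^ (- b)) * u k +
      k%:R `^ (- b) * (B1 * k%:R `^ s + B2 * k%:R `^ (- b)).
  move=> k0 b1.
  have h := tracking_error_recursion (alpha := alpha) (beta := beta)
    fv_C1 gw_C1 fv_int gw_int xi_indep xi_law x_init y_init x_step z_step y_step
    hLg reg g_smooth hsigma alpha_itv beta_gt0 k0 b1.
  apply: (le_trans h); rewrite -addrA lerD2l [leRHS]mulrDr /B1 /B2 /alpha /beta.
  rewrite [X in _ <= X + _]mulrCA -powR_step_ratio//.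
  have q0 : 0 < (k%:R : R) `^ (- b) by rewrite powR_gt0 ?ltr0n.
  move: (k%:R `^ (- a)) (k%:R `^ (- b)) q0 => p q q0.
  by rewrite le_eqVlt; apply/orP; left; apply/eqP; field; rewrite gt_eqF.
have B10 : 0 <= B1 by rewrite divr_ge0// mulr_ge0 ?exprn_ge0.
have B20 : 0 <= B2 by rewrite mulr_ge0 ?sqr_ge0.
have u0 k : 0 <= u k by apply: Rintegral_ge0 => t _; exact: sqr_ge0.
have [D D0 hD] := recursion_powR_le hb B10 B20 u0 u_rec.
(* [B1] contains Lg^2: one factor is kept as the Lg of the rate, the other goes into the
   constant. *)
have Gbar_le k : (0 < k)%N ->
    Gbar k <= 2 * (k%:R `^ a * (Fbar k - Fbar k.+1)) +
      Lf ^+ 2 * (C ^+ 2 * (Lg * C ^+ 8 / 8) * (Lg * k%:R `^ s) +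
                 C ^+ 2 * D * k%:R `^ (- b)) +
      LF * C ^+ 4 * k%:R `^ (- a).
  move=> k0.
  have h := descent_step (alpha := alpha) (beta := beta)
    fv_C1 gw_C1 fv_int gw_int xi_indep xi_law x_init y_init x_step z_step y_step
    C0 hLf hLg hLF reg g_smooth F_smooth F_lower unbiased hsigma alpha_itv beta_gt0 k0.
  apply: (le_trans h); rewrite lerD2r mulrA; apply: lerD.
    by rewrite /alpha powRN invrK.
  have LC : 0 <= Lf ^+ 2 * C ^+ 2 by rewrite mulr_ge0 ?sqr_ge0.
  apply: (le_trans (ler_wpM2l LC (hD k k0))).
  by rewrite /B1 le_eqVlt; apply/orP; left; apply/eqP; field.
have Fint k : (0 < k)%N -> P.-integrable setT (EFin \o (fun t => compF mu fv gw (x k t))).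
  case: k => // k _.
  exact: (F_iterate_integrable (alpha := alpha) (beta := beta) fv_C1 gw_C1 fv_int gw_int
    xi_law x_init y_init x_step z_step y_step C0 hLf hLF reg g_smooth F_smooth F_lower
    unbiased alpha_itv).
have Gint k : (0 < k)%N ->
    P.-integrable setT (EFin \o (fun t => enorm (grad (compF mu fv gw) (x k t)) ^+ 2)).
  case: k => // k _.
  exact: (sqr_gradF_integrable (alpha := alpha) (beta := beta) fv_C1 gw_C1 fv_int gw_int
    x_init y_init x_step z_step y_step C0 hLf reg g_smooth unbiased).
have Fbar_itv k : (0 < k)%N -> compF mu fv gw xs <= Fbar k <= M.
  move=> k0; apply/andP; split.
    rewrite -[leLHS](Rintegral_prob_cst P).
    by apply: le_Rintegral => //; [exact: integrable_prob_cst|exact: Fint].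
  by rewrite -lee_fin (EFin_Rintegral (Fint k k0)); have := hM k k0; rewrite unlock.
have AE K : (0 < K)%N -> A K = (K%:R^-1 * \sum_(1 <= k < K.+1) Gbar k)%:E.
  move=> K0; rewrite /A /avg_sq_grad EFinM -sumEFin; congr (_ * _)%E.
  apply: eq_big_nat => k /andP[k0 _]; rewrite unlock.
  by rewrite -(EFin_Rintegral (Gint k k0)).
have main : le_bigO A (rate Lf Lg a b).
  have [|||c c0 hc] := @avg_rate_le R a b Lf Lg (C ^+ 2 * (Lg * C ^+ 8 / 8))
    (C ^+ 2 * D) (LF * C ^+ 4) _ M Fbar Gbar ha hb hLg _ _ _ Fbar_itv Gbar_le.
  - by rewrite mulr_ge0 ?sqr_ge0// divr_ge0// mulr_ge0 ?exprn_ge0.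
  - by rewrite mulr_ge0 ?sqr_ge0.
  - by rewrite mulr_ge0 ?exprn_ge0.
  by exists c => // K K0; rewrite AE// lee_fin hc.
have rate_bound e : 4 * a - 4 * b != 1 -> a - 1 <= e ->
    Lf ^+ 2 * Lg = 0 \/ 4 * b - 4 * a <= e -> - b <= e -> - a <= e ->
    le_bigO A (fun K => K%:R `^ e).
  move=> ab h1 h2 h3 h4; have [c c0 hc] := main.
  have L0 : 0 <= Lf ^+ 2 * Lg by rewrite mulr_ge0 ?sqr_ge0.
  exists (c * (2 + Lf ^+ 2 * Lg + Lf ^+ 2)).
    by rewrite mulr_gt0// ltr_wpDr ?sqr_ge0// ltr_wpDr.
  move=> K K0; apply: (le_trans (hc K K0)); rewrite lee_fin -mulrA ler_wpM2l ?(ltW c0)//.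
  exact: rate_const_le.
split=> //.
(* The exponents a - 1, 4b - 4a and -b all equal -4/9, while -a = -5/9 is smaller. *)
- by move=> _ _ aE bE; apply: rate_bound; rewrite ?aE ?bE; lra.
- move=> LgLf; have L0 : Lf ^+ 2 * Lg = 0.
    by case: LgLf => ->; rewrite ?mulr0// expr0n/= mul0r.
  split=> [a' b' _ _|aE bE].
    (* At a = b = 1/2 the exponent 4b - 4a is 0, but its coefficient vanishes, so the rate is
       O(K^(-1/2)), which [half_rate_le] places below every other rate. *)
    exists (2 + Lf ^+ 2 * Lg + Lf ^+ 2).
      by rewrite L0 addr0 ltr_wpDr ?sqr_ge0.
    move=> K K0; rewrite lee_fin.
    have := @rate_const_le R Lf Lg (1 / 2) (1 / 2) (- (1 / 2)) K K0.
    rewrite L0 subrr => /(_ _ _ _ _ _ _)/le_trans; apply => //.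
    + by rewrite eq_sym oner_eq0.
    + lra.
    + by left.
    + by rewrite ler_wpM2l ?half_rate_le// addr0 addr_ge0 ?sqr_ge0.
  by apply: rate_bound; rewrite ?aE ?bE; lra.
Qed.
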